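(* Let $\Omega=(l,L)\times(0,\pi)$ be split into $N\ge 2$ vertical strips $\Omega_i=(x_{i-1},x_i)\times(0,\pi)$, $l=x_0<x_1<\dots<x_N=L$, let $d_i=x_i-x_{i-1}$ and $d_{\min}=\min_{1\le i\le N}d_i$, and let $c>0$ be the wave propagation speed. Let $\theta=1/2$, let $k\ge1$ be an integer and let $T\in(0,\infty)$ be a fixed time window length. If $$\frac{T}{k}<\frac{d_{\min}}{c},$$ then the two-dimensional Dirichlet-Neumann waveform relaxation (DNWR) algorithm (written for the error, as defined in the context) achieves convergence in at most $k+1$ iterations; that is, the error iterates of iteration $k+1$ satisfy $e_i^{k+1}=0$ on $\Omega_i\times(0,T)$ for all $1\le i\le N$.
   Context: Let $c>0$ (wave speed), $\tau>0$ (delay), $\lambda\in\mathbb{R}$ (free parameter), $T>0$. The underlying problem is the two-dimensional wave equation with constant time delay $w_{tt}=c^2(w_{xx}+w_{yy})+\lambda w(x,y,t-\tau)+f(x,y,t)$ on $\Omega$, with $w$ and $w_t$ prescribed for $-\tau\le t\le 0$ and Dirichlet boundary conditions on $\partial\Omega$. By linearity, the algorithm is studied through the error equations, in which all data (source, history, and values on $\partial\Omega$) are zero. DNWR algorithm for the error. Put $m=\lceil N/2\rceil$ (index of the middle subdomain). Let initial guesses $\kappa_i^0(y,t)$, $(y,t)\in(0,\pi)\times(0,T)$, be given along the interfaces $\{x=x_i\}$, $1\le i\le N-1$, and set $\kappa_0^k=\kappa_N^k=0$ for all $k\ge0$ (homogeneous outer Dirichlet condition). For iteration $k=1,2,\dots$,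 the function $e_i^k(x,y,t)$ on $\Omega_i$, $1\le i\le N$, satisfies $$\partial_{tt}e_i^k(x,y,t)-c^2\bigl(\partial_{xx}e_i^k(x,y,t)+\partial_{yy}e_i^k(x,y,t)\bigr)-\lambda e_i^k(x,y,t-\tau)=0,\quad (x,y,t)\in\Omega_i\times(0,T),$$ $$e_i^k(x,y,t)=0,\quad \partial_te_i^k(x,y,t)=0,\quad (x,y)\in\Omega_i,\ t\in[-\tau,0],$$ $$e_i^k(x,0,t)=e_i^k(x,\pi,t)=0,\quad t\in(0,T),$$ together with the following conditions in $x$ for $y\in(0,\pi)$, $t\in(0,T)$, the subproblems being solved starting from the middle subdomain and moving outwards. (1) Middle subdomain $\Omega_m$ (Dirichlet-Dirichlet): $e_m^k(x_{m-1},y,t)=\kappa_{m-1}^{k-1}(y,t)$ and $e_m^k(x_m,y,t)=\kappa_m^{k-1}(y,t)$. (2) For $i=m-1,m-2,\dots,1$ (Dirichlet on the left, Neumann on the right): $e_i^k(x_{i-1},y,t)=\kappa_{i-1}^{k-1}(y,t)$ and $\partial_xe_i^k(x_i,y,t)=\partial_xe_{i+1}^k(x_i,y,t)$. (3) For $j=m+1,m+2,\dots,N$ (Neumann on the left, Dirichlet on the right): $\partial_xe_j^k(x_{j-1},y,t)=\partial_xe_{j-1}^k(x_{j-1},y,t)$ and $e_j^k(x_j,y,t)=\kappa_j^{k-1}(y,t)$. The interface values are then updated, with relaxation parameter $\theta\in(0,1]$, by $$\kappa_i^k(y,t)=\theta e_i^k(x_i,y,t)+(1-\theta)\kappa_i^{k-1}(y,t),\quad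 1\le i<m,$$ $$\kappa_j^k(y,t)=\theta e_{j+1}^k(x_j,y,t)+(1-\theta)\kappa_j^{k-1}(y,t),\quad m\le j\le N-1.$$ Convergence of the algorithm in a given number of iterations means that the errors $e_i^k$ vanish in all subdomains over the whole time window $(0,T)$ at that iteration. *)

(* Defs.v *)
(* Stdlib reals with Coquelicot. *)
From Stdlib Require Import Reals RList List Arith.
From Coquelicot Require Import Coquelicot.
Import ListNotations.
Open Scope R_scope.

(** Functions of [(x, y, t)] are total on [R * R * R]; only their values on the
    relevant space-time cylinder are constrained. *)
Definition point : Type := (R * R * R)%type.

(** [is_derive] with the filter [locally x] restricted to [D]: on a closed interval
    this is the derivative inside and the one-sided derivative at the end points. *)
Definition is_derive_within (D : R -> Prop) (f : R -> R) (x l : R) : Prop :=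
  filterdiff (K := R_AbsRing) (U := R_NormedModule) (V := R_NormedModule)
    f (within D (locally x)) (fun h => scal h l).

Definition dx_on (Q : point -> Prop) (u : point -> R) (x y t l : R) : Prop :=
  is_derive_within (fun s => Q (s, y, t)) (fun s => u (s, y, t)) x l.

Definition dy_on (Q : point -> Prop) (u : point -> R) (x y t l : R) : Prop :=
  is_derive_within (fun s => Q (x, s, t)) (fun s => u (x, s, t)) y l.

Definition dt_on (Q : point -> Prop) (u : point -> R) (x y t l : R) : Prop :=
  is_derive_within (fun s => Q (x, y, s)) (fun s => u (x, y, s)) t l.

Record C1_with (Q : point -> Prop) (u ux uy ut : point -> R) : Prop := {
  C1_cont : continuous_on Q u;
  C1_cont_x : continuous_on Q ux;
  C1_cont_y : continuous_on Q uy;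
  C1_cont_t : continuous_on Q ut;
  C1_dx : forall x y t, Q (x, y, t) -> dx_on Q u x y t (ux (x, y, t));
  C1_dy : forall x y t, Q (x, y, t) -> dy_on Q u x y t (uy (x, y, t));
  C1_dt : forall x y t, Q (x, y, t) -> dt_on Q u x y t (ut (x, y, t))
}.

Definition C1_on (Q : point -> Prop) (u : point -> R) : Prop :=
  exists ux uy ut, C1_with Q u ux uy ut.

Definition C2_on (Q : point -> Prop) (u : point -> R) : Prop :=
  exists ux uy ut,
    C1_with Q u ux uy ut /\ C1_on Q ux /\ C1_on Q uy /\ C1_on Q ut.

(** The strips are [Omega_i = (x (i-1), x i) * (0, PI)], [1 <= i <= N]. *)
Definition in_strip (x : nat -> R) (i : nat) (s y : R) : Prop :=
  x (i - 1)%nat < s < x i /\ 0 < y < PI.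

Definition open_cyl (x : nat -> R) (T : R) (i : nat) : point -> Prop :=
  fun '(s, y, t) => in_strip x i s y /\ 0 < t < T.

(** Closure of the strip in space, history included in time. *)
Definition closed_cyl (x : nat -> R) (tau T : R) (i : nat) : point -> Prop :=
  fun '(s, y, t) =>
    x (i - 1)%nat <= s <= x i /\ 0 <= y <= PI /\ - tau <= t < T.

Definition width (x : nat -> R) (i : nat) : R := x i - x (i - 1)%nat.

(** [MinRlist] is the minimum of a nonempty list. *)
Definition dmin (x : nat -> R) (N : nat) : R :=
  MinRlist (map (width x) (seq 1 N)).

(** [ceil (N / 2)] *)
Definition middle (N : nat) : nat := Nat.div2 (N + 1).

(** Classical solution in the [i]-th strip of the delayed wave equation with zero
    source, zero history and zero values on [y = 0] and [y = PI]: [C^2] in the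
    interior and [C^1] up to the boundary, so that all traces and normal derivatives
    on the interfaces make sense. *)
Record error_solution (c tau lam T : R) (x : nat -> R) (i : nat)
    (u : point -> R) : Prop := {
  sol_C1 : C1_on (closed_cyl x tau T i) u;
  sol_C2 : C2_on (open_cyl x T i) u;
  sol_wave : forall s y t, in_strip x i s y -> 0 < t < T ->
    Derive_n (fun t' => u (s, y, t')) 2 t
    - c ^ 2 * (Derive_n (fun s' => u (s', y, t)) 2 s
               + Derive_n (fun y' => u (s, y', t)) 2 y)
    - lam * u (s, y, t - tau) = 0;
  sol_history : forall s y t, in_strip x i s y -> - tau <= t <= 0 ->
    u (s, y, t) = 0 /\ dt_on (closed_cyl x tau T i) u s y t 0;
  sol_sides : forall s t, x (i - 1)%nat < s < x i -> 0 < t < T ->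
    u (s, 0, t) = 0 /\ u (s, PI, t) = 0
}.

Definition dirichlet (T p : R) (u : point -> R) (g : R -> R -> R) : Prop :=
  forall y t, 0 < y < PI -> 0 < t < T -> u (p, y, t) = g y t.

(** The [x]-derivatives of [u] in strip [i] and of [v] in strip [j], each taken from
    its own strip, agree on the interface [x = p]. *)
Definition neumann (x : nat -> R) (tau T p : R) (i : nat) (u : point -> R)
    (j : nat) (v : point -> R) : Prop :=
  forall y t, 0 < y < PI -> 0 < t < T ->
    exists q, dx_on (closed_cyl x tau T i) u p y t q
           /\ dx_on (closed_cyl x tau T j) v p y t q.

(** One iteration: [kap] are the current interface values, [e] the subdomain errors
    computed from them, [kap'] the updated interface values. *)
Record dnwr_step (c tau lam T theta : R) (x : nat -> R) (N : nat)
    (kap : nat -> R -> R -> R) (e : nat -> point -> R)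
    (kap' : nat -> R -> R -> R) : Prop := {
  step_solution : forall i, (1 <= i <= N)%nat ->
    error_solution c tau lam T x i (e i);
  step_middle :
    let m := middle N in
    dirichlet T (x (m - 1)%nat) (e m) (kap (m - 1)%nat) /\
    dirichlet T (x m) (e m) (kap m);
  step_left : forall i, (1 <= i < middle N)%nat ->
    dirichlet T (x (i - 1)%nat) (e i) (kap (i - 1)%nat) /\
    neumann x tau T (x i) i (e i) (i + 1) (e (i + 1)%nat);
  step_right : forall j, (middle N < j <= N)%nat ->
    neumann x tau T (x (j - 1)%nat) j (e j) (j - 1) (e (j - 1)%nat) /\
    dirichlet T (x j) (e j) (kap j);
  step_update_left : forall i, (1 <= i < middle N)%nat ->
    forall y t, 0 < y < PI -> 0 < t < T ->
    kap' i y t = theta * e i (x i, y, t) + (1 - theta) * kap i y t;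
  step_update_right : forall j, (middle N <= j <= N - 1)%nat ->
    forall y t, 0 < y < PI -> 0 < t < T ->
    kap' j y t = theta * e (j + 1)%nat (x j, y, t) + (1 - theta) * kap j y t
}.

(** [kap k i] is [kappa_i^k] ([k >= 0]) and [e k i] is [e_i^k] ([k >= 1]; the values
    [e 0] are not used). *)
Record dnwr (c tau lam T theta : R) (x : nat -> R) (N : nat)
    (kap : nat -> nat -> R -> R -> R) (e : nat -> nat -> point -> R) : Prop := {
  dnwr_outer : forall k y t, 0 < y < PI -> 0 < t < T ->
    kap k 0%nat y t = 0 /\ kap k N y t = 0;
  dnwr_iter : forall k : nat,
    dnwr_step c tau lam T theta x N (kap k) (e (S k)) (kap (S k))
}.

(* Main.v *)
Require Import Defs.
From Stdlib Require Import Reals RList List Lra Lia Classical IndefiniteDescription.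
From Coquelicot Require Import Coquelicot.
Open Scope R_scope.

(** With [theta = 1/2] the new value on each interface is the mean of the traces from its
    two sides. Add to the error on the right of the interface the reflection of the error
    on the left: by the Neumann transmission condition this sum solves the delayed wave
    equation with zero normal derivative on the interface, and its trace there is twice
    the new interface value. If the old interface values vanish for [t < T0], so do all
    errors of the iteration (uniqueness in each strip, from the middle outwards), hence by
    finite speed of propagation the new interface values vanish for [t < T0 + d / c],
    for any [d] below the smallest width. After [k] iterations all of [(0, T)] is covered.

    Uniqueness and finite speed both follow from the decay of an energy weighted by a
    function [chi s t], constant or vanishing outside a cone. The delay is treated by
    steps of length [tau]: on each step the delayed term is already known to vanish
    where [chi > 0]. *)

(** In the energy balance the flux through a face of constant $x$ is a multiple of $u_x u_t$. A zero
    Neumann trace kills the first factor; a zero Dirichlet trace kills the second, after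
    differentiation in time. Hence the middle strip, the mixed strips and the reflected problem all
    fall under one estimate. The reflected sum has zero normal derivative on one face, but on its
    other face nothing is known after the time [T0]; a weight supported in a cone shuts that face
    out exactly from then on. The sum has to live on an interval of distances that fits into both
    neighbours of the interface, and this is where the smallest width enters. The iteration [k + 1]
    is the price for passing from vanishing interface values to vanishing errors. *)

(** * Continuity and differentiation of integrals with a parameter *)

Lemma continuous_pair {U V W : UniformSpace} (f : U -> V) (g : U -> W) (q : U) :
  continuous f q -> continuous g q -> continuous (fun q => (f q, g q)) q.
Proof.
intros Hf Hg P [d Hd]. unfold filtermap.
generalize (filter_and _ _ (proj1 (filterlim_locally _ _) Hf d) (proj1 (filterlim_locally _ _) Hg d)).
apply filter_imp. intros u Hu. apply Hd. exact Hu.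
Qed.

Lemma continuous_point {U : UniformSpace} (f : point -> R) (u v w : U -> R) (q : U) :
  continuous f (u q, v q, w q) ->
  continuous u q -> continuous v q -> continuous w q ->
  continuous (fun q => f (u q, v q, w q)) q.
Proof.
intros Hf Hu Hv Hw.
apply (continuous_comp (fun q => (u q, v q, w q)) f); [| exact Hf].
apply @continuous_pair; [| exact Hw]. now apply @continuous_pair.
Qed.

(** The tube lemma: a radius is chosen at each [s], and compactness of $[a,b]$ yields one radius in
    [q] that serves all of them. *)
Lemma tube_interval {U : UniformSpace} (P : R -> U -> Prop) (a b : R) (q0 : U) :
  (forall s, a <= s <= b -> locally (s, q0) (fun p => P (fst p) (snd p))) ->
  locally q0 (fun q => forall s, a <= s <= b -> P s q).
Proof.
intros H.
assert (Hd : forall s, exists d : posreal, a <= s <= b ->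
   forall p : R * U, ball (s, q0) d p -> P (fst p) (snd p)).
{ intros s. destruct (classic (a <= s <= b)) as [h | h].
  - destruct (H s h) as [d Hd]. exists d. intros _ p Hp. apply Hd, Hp.
  - exists (mkposreal 1 Rlt_0_1). tauto. }
apply functional_choice in Hd. destruct Hd as [del Hd].
destruct (compactness_value_1d a b del) as [d Hc].
exists d. intros q Hq s Hs.
apply NNPP. intros Hn. apply (Hc s Hs). intros (u & Hu & Hsu & Hdu). apply Hn.
apply (Hd u Hu (s, q)). split; simpl.
- exact Hsu.
- eapply ball_le; [| exact Hq]. exact Hdu.
Qed.

Lemma continuous_RInt_param {U : UniformSpace} (D : U -> Prop) (f : R -> U -> R) (a b : R) :
  a <= b -> open D ->
  (forall s q, a <= s <= b -> D q -> continuous (fun p : R * U => f (fst p) (snd p)) (s, q)) ->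
  forall q, D q -> continuous (fun q => RInt (fun s => f s q) a b) q.
Proof.
intros Hab HD Hf q0 Hq0.
assert (Hex : forall q, D q -> ex_RInt (fun s => f s q) a b).
{ intros q Hq. apply @ex_RInt_continuous. rewrite Rmin_left, Rmax_right by lra.
  intros z Hz. apply (continuous_comp (fun s => (s, q)) (fun p => f (fst p) (snd p))).
  - apply @continuous_pair. apply continuous_id. apply continuous_const.
  - apply Hf; assumption. }
apply filterlim_locally. intros eps.
(* The summand 1 keeps the denominator positive when [a = b]; the factor 2 makes the final estimate
   strict. *)
assert (Heps : 0 < eps / (2 * (b - a + 1))).
{ apply Rdiv_lt_0_compat. apply eps. lra. }
remember (mkposreal _ Heps) as eta eqn:Eeta.
assert (Ht : locally q0 (fun q => forall s, a <= s <= b -> Rabs (f s q - f s q0) <= eta)).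
{ apply (tube_interval (fun s q => Rabs (f s q - f s q0) <= eta)).
  intros s Hs.
  pose proof (Hf s q0 Hs Hq0) as Hc.
  assert (He2 : 0 < eta / 2) by (apply Rdiv_lt_0_compat; [apply (cond_pos eta) | lra]).
  destruct (proj1 (filterlim_locally _ _) Hc (mkposreal _ He2)) as [d Hd].
  exists d. intros [s' q'] Hp. simpl.
  pose proof (Hd (s', q') Hp) as h1.
  assert (h2 := Hd (s', q0)). simpl in h1, h2.
  assert (h3 : ball (s, q0) d (s', q0)). { split; [apply Hp | apply ball_center]. }
  specialize (h2 h3).
  change (Rabs (f s' q' - f s q0) < eta / 2) in h1.
  change (Rabs (f s' q0 - f s q0) < eta / 2) in h2.
  apply Rabs_def2 in h1. apply Rabs_def2 in h2. apply Rabs_le. lra. }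
generalize (filter_and _ _ Ht (HD q0 Hq0)). apply filter_imp.
intros q [Hq HDq].
change (Rabs (RInt (fun s => f s q) a b - RInt (fun s => f s q0) a b) < eps).
rewrite <- (RInt_minus (V := R_CompleteNormedModule) (fun s => f s q) (fun s => f s q0)); [| now apply Hex ..].
eapply Rle_lt_trans.
- apply abs_RInt_le_const; [exact Hab | | exact Hq].
  apply @ex_RInt_minus; now apply Hex.
- rewrite Eeta; simpl.
  replace ((b - a) * (eps / (2 * (b - a + 1)))) with (eps * ((b-a) / (2 * (b - a + 1)))) by (field; lra).
  rewrite <- (Rmult_1_r eps) at 2. apply Rmult_lt_compat_l. apply eps.
  apply Rlt_div_l; lra.
Qed.

(** The Leibniz rule with margins: joint continuity of the derivative is needed in full
    neighbourhoods of the end points [a] and [b] too, so the hypotheses live on a larger open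
    interval. A box shrunk inside the open strip provides such margins. *)
Lemma is_derive_RInt_open (f f' : R -> R -> R) (A B a b : R) (D : R -> Prop) (t0 : R) :
  A < a -> a <= b -> b < B -> open D -> D t0 ->
  (forall s t, A < s < B -> D t -> is_derive (f s) t (f' s t)) ->
  (forall s t, A < s < B -> D t -> continuous (fun p : R * R => f' (fst p) (snd p)) (s, t)) ->
  (forall s t, A < s < B -> D t -> continuous (fun s => f s t) s) ->
  is_derive (fun t => RInt (fun s => f s t) a b) t0 (RInt (fun s => f' s t0) a b).
Proof.
intros HA Hab HB HD Ht0 Hder Hc' Hc.
replace (RInt (fun s => f' s t0) a b) with (RInt (fun s => Derive (fun t => f s t) t0) a b).
2:{ apply RInt_ext. intros s Hs. rewrite Rmin_left, Rmax_right in Hs by lra.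
    apply is_derive_unique, Hder; auto; lra. }
apply (is_derive_RInt_param (fun t s => f s t)); rewrite ?Rmin_left, ?Rmax_right by lra.
- generalize (HD t0 Ht0). apply filter_imp. intros t Ht s Hs. eexists. apply Hder; auto; lra.
- intros s Hs. apply continuity_2d_pt_filterlim.
  match goal with |- filterlim _ _ (locally ?l) => replace l with (f' s t0) end.
  2:{ symmetry. apply is_derive_unique, Hder; auto; lra. }
  assert (HO : locally (t0, s) (fun p : R * R => A < snd p < B /\ D (fst p))).
  { destruct (HD t0 Ht0) as [d Hd].
    assert (He : 0 < Rmin d (Rmin (s - A) (B - s))).
    { repeat apply Rmin_glb_lt; try lra. apply d. }
    exists (mkposreal _ He). intros [t' s'] [h1 h2]. simpl in *.
    change (Rabs (s' - s) < Rmin d (Rmin (s - A) (B - s))) in h2.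
    split.
    - pose proof (Rmin_r d (Rmin (s - A) (B - s))). pose proof (Rmin_l (s - A) (B - s)).
      pose proof (Rmin_r (s - A) (B - s)). apply Rabs_def2 in h2. lra.
    - apply Hd. eapply ball_le; [| exact h1]. apply Rmin_l. }
  apply (filterlim_ext_loc (fun p : R * R => f' (snd p) (fst p))).
  + generalize HO. apply filter_imp. intros p [h1 h2]. symmetry. apply is_derive_unique. now apply Hder.
  + apply (continuous_comp (fun p : R * R => (snd p, fst p)) (fun p => f' (fst p) (snd p))).
    * intros P [d Hd]. exists d. intros [u v] [h1 h2]. apply Hd. split; assumption.
    * apply Hc'; auto; simpl; lra.
- generalize (HD t0 Ht0). apply filter_imp. intros t Ht. apply @ex_RInt_continuous.
  rewrite Rmin_left, Rmax_right by lra. intros s Hs. apply Hc; auto; lra.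
Qed.

(** * Energy balance on boxes *)

Definition open_box (a b T : R) : point -> Prop :=
  fun '(s, y, t) => a < s < b /\ 0 < y < PI /\ 0 < t < T.

Lemma open_strict_between (a b : R) : open (fun s => a < s < b).
Proof. apply open_and; [apply open_gt | apply open_lt]. Qed.

Lemma open_rectangle (a b c d : R) :
  open (fun q : R * R => a < fst q < b /\ c < snd q < d).
Proof.
apply open_and.
- apply (open_comp (fst : R * R -> R) (fun s => a < s < b)); [| apply open_strict_between].
  intros [u v] _. apply continuous_fst.
- apply (open_comp (snd : R * R -> R) (fun s => c < s < d)); [| apply open_strict_between].
  intros [u v] _. apply continuous_snd.
Qed.

(** Divergence theorem for a balance law with sign: only the flux through the four sides can raise
    the integral of [p], and [2 * ((B - A) + (D - C))] is the perimeter of the rectangle. *)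
Lemma box_flux (a b T : R) (p pt f fs g gy : point -> R) (A B C D eta t0 : R) :
  a < A -> A <= B -> B < b -> 0 < C -> C <= D -> D < PI -> 0 < t0 < T ->
  (forall z, open_box a b T z -> continuous p z /\ continuous pt z /\ continuous f z
     /\ continuous fs z /\ continuous g z /\ continuous gy z) ->
  (forall s y t, open_box a b T (s, y, t) ->
     is_derive (fun t => p (s, y, t)) t (pt (s, y, t)) /\
     is_derive (fun s => f (s, y, t)) s (fs (s, y, t)) /\
     is_derive (fun y => g (s, y, t)) y (gy (s, y, t))) ->
  (forall s y, A <= s <= B -> C <= y <= D ->
     pt (s, y, t0) + fs (s, y, t0) + gy (s, y, t0) <= 0) ->
  (forall y, C <= y <= D -> Rabs (f (A, y, t0)) <= eta /\ Rabs (f (B, y, t0)) <= eta) ->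
  (forall s, A <= s <= B -> Rabs (g (s, C, t0)) <= eta /\ Rabs (g (s, D, t0)) <= eta) ->
  exists l, is_derive (fun t => RInt (fun y => RInt (fun s => p (s, y, t)) A B) C D) t0 l
    /\ l <= 2 * eta * ((B - A) + (D - C)).
Proof.
intros HA HAB HB HC HCD HD Ht0 Hc Hd Hdiv Hf Hg.
assert (Hcs : forall h : point -> R, (forall z, open_box a b T z -> continuous h z) ->
  forall s y t, a < s < b -> 0 < y < PI -> 0 < t < T -> continuous (fun s => h (s, y, t)) s).
{ intros h Hh s y t Hs Hy Ht. apply (continuous_point h (fun s => s) (fun _ => y) (fun _ => t)).
  apply Hh; repeat split; lra. apply continuous_id. apply continuous_const. apply continuous_const. }
assert (Hint : forall h : point -> R, (forall z, open_box a b T z -> continuous h z) ->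
  forall y t, 0 < y < PI -> 0 < t < T -> ex_RInt (fun s => h (s, y, t)) A B).
{ intros h Hh y t Hy Ht. apply @ex_RInt_continuous. rewrite Rmin_left, Rmax_right by lra.
  intros s Hs. apply Hcs; auto; lra. }
assert (HcI : forall h : point -> R, (forall z, open_box a b T z -> continuous h z) ->
  forall y t, 0 < y < PI -> 0 < t < T ->
  continuous (fun q : R * R => RInt (fun s => h (s, fst q, snd q)) A B) (y, t)).
{ intros h Hh y t Hy Ht.
  apply (continuous_RInt_param (fun q : R * R => 0 < fst q < PI /\ 0 < snd q < T)
     (fun s q => h (s, fst q, snd q)) A B HAB); [apply open_rectangle | | split; simpl; lra].
  intros s [y' t'] Hs [h1 h2]. simpl in h1, h2.
  apply (continuous_point h (fun q => fst q) (fun q => fst (snd q)) (fun q => snd (snd q))).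
  - apply Hh; simpl; repeat split; lra.
  - apply continuous_fst.
  - apply (continuous_comp snd fst). apply continuous_snd. apply continuous_fst.
  - apply (continuous_comp snd snd). apply continuous_snd. apply continuous_snd. }
assert (HcIy : forall h : point -> R, (forall z, open_box a b T z -> continuous h z) ->
  forall y t, 0 < y < PI -> 0 < t < T ->
  continuous (fun y => RInt (fun s => h (s, y, t)) A B) y).
{ intros h Hh y t Hy Ht.
  apply (continuous_comp (fun y => (y, t)) (fun q : R * R => RInt (fun s => h (s, fst q, snd q)) A B)).
  apply @continuous_pair. apply continuous_id. apply continuous_const. now apply HcI. }
assert (HII : forall h : point -> R, (forall z, open_box a b T z -> continuous h z) ->
  ex_RInt (fun y => RInt (fun s => h (s, y, t0)) A B) C D).
{ intros h Hh. apply @ex_RInt_continuous. rewrite Rmin_left, Rmax_right by lra.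
  intros y Hy. apply HcIy; auto; lra. }
exists (RInt (fun y => RInt (fun s => pt (s, y, t0)) A B) C D). split.
- apply (is_derive_RInt_open (fun y t => RInt (fun s => p (s, y, t)) A B)
    (fun y t => RInt (fun s => pt (s, y, t)) A B) 0 PI C D (fun t => 0 < t < T));
    auto; try lra.
  + apply open_strict_between.
  + intros y t Hy Ht.
    apply (is_derive_RInt_open (fun s t => p (s, y, t)) (fun s t => pt (s, y, t))
      a b A B (fun t => 0 < t < T)); auto; try lra.
    * apply open_strict_between.
    * intros s t' Hs Ht'. apply Hd. repeat split; lra.
    * intros s t' Hs Ht'. apply (continuous_point pt (fun q => fst q) (fun _ => y) (fun q => snd q)).
      apply Hc; repeat split; simpl; lra. apply continuous_fst. apply continuous_const. apply continuous_snd.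
    * intros s t' Hs Ht'. apply Hcs; auto. apply Hc.
  + intros y t Hy Ht. apply HcI; auto. apply Hc.
  + intros y t Hy Ht. apply HcIy; auto. apply Hc.
(* The $y$-flux is handled by the Leibniz rule in [y] followed by the fundamental theorem of
   calculus, so the order of integration is never exchanged. *)
- assert (Hgy : is_RInt (fun y => RInt (fun s => gy (s, y, t0)) A B) C D
     (RInt (fun s => g (s, D, t0)) A B - RInt (fun s => g (s, C, t0)) A B)).
  { apply (is_RInt_derive (fun y => RInt (fun s => g (s, y, t0)) A B)).
    - rewrite Rmin_left, Rmax_right by lra. intros y Hy.
      apply (is_derive_RInt_open (fun s y => g (s, y, t0)) (fun s y => gy (s, y, t0))
        a b A B (fun y => 0 < y < PI)); auto; try lra.
      + apply open_strict_between.
      + intros s t' Hs Ht'. apply Hd. repeat split; lra.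
      + intros s t' Hs Ht'. apply (continuous_point gy (fun q => fst q) (fun q => snd q) (fun _ => t0)).
        apply Hc; repeat split; simpl; lra. apply continuous_fst. apply continuous_snd. apply continuous_const.
      + intros s t' Hs Ht'. apply Hcs; auto. apply Hc.
    - rewrite Rmin_left, Rmax_right by lra. intros y Hy. apply HcIy; auto; try lra. apply Hc. }
  assert (Hin : forall y, C <= y <= D ->
     RInt (fun s => pt (s, y, t0)) A B <= 2 * eta - RInt (fun s => gy (s, y, t0)) A B).
  { intros y Hy.
    assert (Hfs : is_RInt (fun s => fs (s, y, t0)) A B (f (B, y, t0) - f (A, y, t0))).
    { apply (is_RInt_derive (fun s => f (s, y, t0))); rewrite Rmin_left, Rmax_right by lra; intros s Hs.
      - apply Hd. repeat split; lra.
      - apply Hcs; try lra. apply Hc. }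
    destruct (Hf y Hy) as [h1 h2]. apply Rabs_le_between in h1. apply Rabs_le_between in h2.
    assert (Hle : RInt (fun s => pt (s, y, t0)) A B <=
       RInt (fun s => - fs (s, y, t0) + - gy (s, y, t0)) A B).
    { apply RInt_le; auto.
      - apply Hint; try lra. apply Hc.
      - apply @ex_RInt_plus; apply @ex_RInt_opp; apply Hint; try lra; apply Hc.
      - intros s Hs. pose proof (Hdiv s y ltac:(lra) Hy). lra. }
    assert (Heq : RInt (fun s => - fs (s, y, t0) + - gy (s, y, t0)) A B =
       - (f (B, y, t0) - f (A, y, t0)) + - RInt (fun s => gy (s, y, t0)) A B).
    { apply is_RInt_unique.
      apply (is_RInt_plus (V := R_NormedModule) (fun s => - fs (s, y, t0)) (fun s => - gy (s, y, t0))).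
      - now apply @is_RInt_opp.
      - apply @is_RInt_opp. apply @RInt_correct. apply Hint; try lra. apply Hc. }
    lra. }
  assert (Hb : forall y, y = C \/ y = D -> Rabs (RInt (fun s => g (s, y, t0)) A B) <= (B - A) * eta).
  { intros y Hy. apply abs_RInt_le_const; auto.
    - apply Hint. apply Hc. destruct Hy; lra. auto.
    - intros s Hs. destruct (Hg s Hs). destruct Hy; subst; auto. }
  pose proof (Hb C (or_introl eq_refl)) as h1. pose proof (Hb D (or_intror eq_refl)) as h2.
  apply Rabs_le_between in h1. apply Rabs_le_between in h2.
  assert (Hle : RInt (fun y => RInt (fun s => pt (s, y, t0)) A B) C D <=
     RInt (fun y => 2 * eta - RInt (fun s => gy (s, y, t0)) A B) C D).
  { apply RInt_le; auto.
    - apply HII, Hc.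
    - apply @ex_RInt_minus. apply ex_RInt_const. apply HII, Hc.
    - intros y Hy. apply Hin. lra. }
  assert (Heq : RInt (fun y => 2 * eta - RInt (fun s => gy (s, y, t0)) A B) C D =
     (D - C) * (2 * eta) - (RInt (fun s => g (s, D, t0)) A B - RInt (fun s => g (s, C, t0)) A B)).
  { apply is_RInt_unique.
    apply (is_RInt_minus (V := R_NormedModule) (fun _ => 2 * eta)); [| exact Hgy].
    apply (is_RInt_const (V := R_NormedModule)). }
  lra.
Qed.

Definition closed_box (a b c d u v : R) : point -> Prop :=
  fun '(s, y, t) => a <= s <= b /\ c <= y <= d /\ u <= t <= v.

(** The Heine-Cantor theorem, relative to the closed box: continuity is only assumed within it, so
    both points are compared with a centre that also lies in the box. *)
Lemma uniform_continuity_box (a b c d u v : R) (h : point -> R) (eta : posreal) :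
  continuous_on (closed_box a b c d u v) h ->
  exists delta : posreal, forall s y t s' y' t',
    closed_box a b c d u v (s, y, t) -> closed_box a b c d u v (s', y', t') ->
    Rabs (s' - s) < delta -> Rabs (y' - y) < delta -> Rabs (t' - t) < delta ->
    Rabs (h (s', y', t') - h (s, y, t)) < eta.
Proof.
intros Hh.
(* [Compactness.Tn 3 R] nests its pairs to the right and ends in a unit, whereas [point] nests to
   the left. *)
pose (inj := fun z : Compactness.Tn 3 R => let '(s, (y, (t, _))) := z in (s, y, t) : point).
(* The radius is doubled because the first point is within [r0] of the centre and the second within
   a further [r <= r0] of the first. *)
assert (Hd : forall z : Compactness.Tn 3 R, exists r : posreal,
  closed_box a b c d u v (inj z) ->
  forall w, ball (inj z) (2 * r) w -> closed_box a b c d u v w ->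
    Rabs (h w - h (inj z)) < eta / 2).
{ intros z. destruct (classic (closed_box a b c d u v (inj z))) as [Hz | Hz].
  - assert (He : 0 < eta / 2) by (apply Rdiv_lt_0_compat; [apply eta | lra]).
    destruct (proj1 (filterlim_locally _ _) (Hh _ Hz) (mkposreal _ He)) as [r Hr].
    assert (Hr2 : 0 < r / 2) by (apply Rdiv_lt_0_compat; [apply r | lra]).
    exists (mkposreal _ Hr2). intros _ w Hw Hbw. apply Hr; auto.
    simpl in Hw. replace (2 * (r / 2)) with (pos r) in Hw by field. exact Hw.
  - exists (mkposreal 1 Rlt_0_1). tauto. }
apply functional_choice in Hd. destruct Hd as [del Hd].
destruct (compactness_value 3 (a, (c, (u, tt))) (b, (d, (v, tt))) del) as [r Hr].
exists r. intros s y t s' y' t' Hz Hz' Hs Hy Ht.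
apply NNPP. intros Hn. apply (Hr (s, (y, (t, tt)))).
{ simpl. simpl in Hz. tauto. }
intros ([s0 [y0 [t0 []]]] & Hb0 & Hc0 & Hr0). apply Hn.
pose proof (Hd (s0, (y0, (t0, tt)))) as H0. unfold inj in H0.
change (r <= del (s0, (y0, (t0, tt)))) in Hr0.
simpl in Hb0, Hc0.
remember (del (s0, (y0, (t0, tt)))) as r0 eqn:E0. clear E0.
assert (Hin0 : closed_box a b c d u v (s0, y0, t0)) by (simpl; tauto).
pose proof (cond_pos r0) as Hpos.
assert (h1 : Rabs (h (s, y, t) - h (s0, y0, t0)) < eta / 2).
{ apply H0; auto.
  destruct Hc0 as (g1 & g2 & g3 & _).
  repeat split; simpl.
  - change (Rabs (s - s0) < 2 * r0). lra.
  - change (Rabs (y - y0) < 2 * r0). lra.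
  - change (Rabs (t - t0) < 2 * r0). lra. }
assert (h2 : Rabs (h (s', y', t') - h (s0, y0, t0)) < eta / 2).
{ apply H0; auto.
  destruct Hc0 as (g1 & g2 & g3 & _).
  apply Rabs_def2 in g1. apply Rabs_def2 in g2. apply Rabs_def2 in g3.
  apply Rabs_def2 in Hs. apply Rabs_def2 in Hy. apply Rabs_def2 in Ht.
  repeat split; simpl.
  - change (Rabs (s' - s0) < 2 * r0). apply Rabs_def1; lra.
  - change (Rabs (y' - y0) < 2 * r0). apply Rabs_def1; lra.
  - change (Rabs (t' - t0) < 2 * r0). apply Rabs_def1; lra. }
apply Rabs_def2 in h1. apply Rabs_def2 in h2. apply Rabs_def1; lra.
Qed.

Lemma RInt_ge_subinterval (h : R -> R) (a b u v m : R) :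
  a <= u -> u <= v -> v <= b ->
  (forall s, a <= s <= b -> continuous h s) ->
  (forall s, a <= s <= b -> 0 <= h s) ->
  (forall s, u <= s <= v -> m <= h s) ->
  (v - u) * m <= RInt h a b.
Proof.
intros Hu Huv Hv Hc H0 Hm.
assert (Hex : forall x y, a <= x -> x <= y -> y <= b -> ex_RInt h x y).
{ intros x y Hx Hxy Hy. apply @ex_RInt_continuous. rewrite Rmin_left, Rmax_right by lra.
  intros z Hz. apply Hc. lra. }
rewrite <- (RInt_Chasles h a u b), <- (RInt_Chasles h u v b); try (apply Hex; lra).
change (plus (RInt h a u) (plus (RInt h u v) (RInt h v b)))
  with (RInt h a u + (RInt h u v + RInt h v b)).
assert (0 <= RInt h a u) by (apply RInt_ge_0; [lra | apply Hex; lra | intros; apply H0; lra]).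
assert (0 <= RInt h v b) by (apply RInt_ge_0; [lra | apply Hex; lra | intros; apply H0; lra]).
assert ((v - u) * m <= RInt h u v).
{ replace ((v - u) * m) with (RInt (fun _ => m) u v) by apply (RInt_const (V := R_CompleteNormedModule)).
  apply RInt_le; [lra | apply ex_RInt_const | apply Hex; lra | intros; apply Hm; lra]. }
lra.
Qed.

(** Second derivatives may blow up at the faces, so the energy identity is used on a box
    shrunk by [eps]; the flux through its faces is small by uniform continuity of the
    first derivatives. *)
Lemma energy_vanishes (a b T : R) (p pt f fs g gy : point -> R) (s0 y0 t2 : R) :
  (forall z, open_box a b T z -> continuous p z /\ continuous pt z /\ continuous f z
     /\ continuous fs z /\ continuous g z /\ continuous gy z) ->
  (forall s y t, open_box a b T (s, y, t) ->
     is_derive (fun t => p (s, y, t)) t (pt (s, y, t)) /\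
     is_derive (fun s => f (s, y, t)) s (fs (s, y, t)) /\
     is_derive (fun y => g (s, y, t)) y (gy (s, y, t))) ->
  continuous_on (closed_box a b 0 PI 0 t2) p ->
  continuous_on (closed_box a b 0 PI 0 t2) f ->
  continuous_on (closed_box a b 0 PI 0 t2) g ->
  (forall z, open_box a b T z -> 0 <= p z) ->
  (forall z, open_box a b T z -> pt z + fs z + gy z <= 0) ->
  (forall y t, 0 < y < PI -> 0 < t < T -> f (a, y, t) = 0 /\ f (b, y, t) = 0) ->
  (forall s t, a < s < b -> 0 < t < T -> g (s, 0, t) = 0 /\ g (s, PI, t) = 0) ->
  (forall s y, a < s < b -> 0 < y < PI -> p (s, y, 0) = 0) ->
  open_box a b T (s0, y0, t2) -> p (s0, y0, t2) = 0.
Proof.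
intros Hc Hd Hcp Hcf Hcg Hp0 Hdiv Hf Hg Hinit H0.
pose proof H0 as H0'. destruct H0' as (Hs0 & Hy0 & Ht2).
destruct (Rle_lt_or_eq_dec _ _ (Hp0 _ H0)) as [Hpos | He]; [exfalso | now symmetry].
set (m0 := p (s0, y0, t2)) in *.
(* A positive density persists on a square around the point. The room [2 * r] to each face
   guarantees that the box shrunk by [eps <= r] still contains that square, whence the lower bound
   [m] for the energy at time [t2]. *)
assert (Hr : exists r, 0 < r /\ a <= s0 - 2 * r /\ s0 + 2 * r <= b /\ 0 <= y0 - 2 * r /\ y0 + 2 * r <= PI
  /\ forall s y, s0 - r <= s <= s0 + r -> y0 - r <= y <= y0 + r -> m0 / 2 <= p (s, y, t2)).
{ assert (Hm2 : 0 < m0 / 2) by lra.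
  destruct (proj1 (filterlim_locally _ _) (proj1 (Hc _ H0)) (mkposreal _ Hm2)) as [d Hdd].
  exists (Rmin (d / 2) (Rmin (Rmin ((s0 - a) / 2) ((b - s0) / 2)) (Rmin (y0 / 2) ((PI - y0) / 2)))).
  pose proof (cond_pos d).
  set (r := Rmin _ _).
  assert (r <= d / 2) by apply Rmin_l.
  assert (r <= (s0 - a) / 2) by (eapply Rle_trans; [apply Rmin_r |]; eapply Rle_trans; [apply Rmin_l | apply Rmin_l]).
  assert (r <= (b - s0) / 2) by (eapply Rle_trans; [apply Rmin_r |]; eapply Rle_trans; [apply Rmin_l | apply Rmin_r]).
  assert (r <= y0 / 2) by (eapply Rle_trans; [apply Rmin_r |]; eapply Rle_trans; [apply Rmin_r | apply Rmin_l]).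
  assert (r <= (PI - y0) / 2) by (eapply Rle_trans; [apply Rmin_r |]; eapply Rle_trans; [apply Rmin_r | apply Rmin_r]).
  assert (0 < r) by (unfold r; repeat apply Rmin_glb_lt; lra).
  repeat split; try lra.
  intros s y Hs Hy.
  assert (Hb : ball (s0, y0, t2) d (s, y, t2)).
  { repeat split; simpl.
    - change (Rabs (s - s0) < d). apply Rabs_def1; lra.
    - change (Rabs (y - y0) < d). apply Rabs_def1; lra.
    - apply ball_center. }
  pose proof (Hdd _ Hb) as Hb'. change (Rabs (p (s, y, t2) - m0) < m0 / 2) in Hb'.
  apply Rabs_def2 in Hb'. lra. }
destruct Hr as (r & Hr & Hra & Hrb & Hrc & Hrd & Hpr).
pose proof PI_RGT_0 as HPI.
set (m := 2 * r * (2 * r * (m0 / 2))).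
assert (Hm : 0 < m) by (unfold m; repeat apply Rmult_lt_0_compat; lra).
(* The energy at [t2] is at most [eta * K]: the first term of [K] bounds the inflow through the
   sides up to time [t2], the second the energy at the initial time [eps]. The choice of [eta] makes
   this [m / 2], against the lower bound [m]. *)
set (K := 2 * ((b - a) + PI) * t2 + (b - a) * PI).
assert (HK : 0 < K).
{ assert (0 < (b - a) * PI) by (apply Rmult_lt_0_compat; lra).
  assert (0 < ((b - a) + PI) * t2) by (apply Rmult_lt_0_compat; lra).
  unfold K. lra. }
assert (Heta : 0 < m / (2 * K)) by (apply Rdiv_lt_0_compat; lra).
set (eta := m / (2 * K)) in *.
destruct (uniform_continuity_box _ _ _ _ _ _ _ (mkposreal _ Heta) Hcp) as [dp Hup].
destruct (uniform_continuity_box _ _ _ _ _ _ _ (mkposreal _ Heta) Hcf) as [df Huf].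
destruct (uniform_continuity_box _ _ _ _ _ _ _ (mkposreal _ Heta) Hcg) as [dg Hug].
simpl in Hup, Huf, Hug.
assert (Heps : exists eps, 0 < eps /\ eps < dp /\ eps < df /\ eps < dg /\ eps <= r /\ eps < t2).
{ exists (Rmin (Rmin (dp / 2) (df / 2)) (Rmin (dg / 2) (Rmin r (t2 / 2)))).
  pose proof (cond_pos dp). pose proof (cond_pos df). pose proof (cond_pos dg).
  set (e := Rmin _ _).
  assert (e <= dp / 2) by (eapply Rle_trans; [apply Rmin_l | apply Rmin_l]).
  assert (e <= df / 2) by (eapply Rle_trans; [apply Rmin_l | apply Rmin_r]).
  assert (e <= dg / 2) by (eapply Rle_trans; [apply Rmin_r | apply Rmin_l]).
  assert (e <= r) by (eapply Rle_trans; [apply Rmin_r |]; eapply Rle_trans; [apply Rmin_r | apply Rmin_l]).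
  assert (e <= t2 / 2) by (eapply Rle_trans; [apply Rmin_r |]; eapply Rle_trans; [apply Rmin_r | apply Rmin_r]).
  assert (0 < e) by (unfold e; repeat apply Rmin_glb_lt; lra).
  lra. }
destruct Heps as (eps & He0 & Hep & Hef & Heg & Her & Het).
set (E := fun t => RInt (fun y => RInt (fun s => p (s, y, t)) (a + eps) (b - eps)) eps (PI - eps)).
assert (Hsmall : Rabs eps < dp /\ Rabs eps < df /\ Rabs eps < dg /\ Rabs 0 < dp /\ Rabs 0 < df /\ Rabs 0 < dg).
{ rewrite Rabs_R0, (Rabs_right eps) by lra. repeat split; auto; apply cond_pos. }
destruct Hsmall as (q1 & q2 & q3 & q4 & q5 & q6).
assert (HE : forall t, 0 < t <= t2 -> exists l, is_derive E t l /\ l <= 2 * eta * ((b - a) + PI)).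
{ intros t Ht.
  destruct (box_flux a b T p pt f fs g gy (a + eps) (b - eps) eps (PI - eps) eta t) as [l [Hl Hle]];
    auto; try lra.
  - intros s y Hs Hy. apply Hdiv. repeat split; lra.
  - intros y Hy. destruct (Hf y t) as [F1 F2]; try lra. split; left.
    + pose proof (Huf a y t (a + eps) y t) as X. rewrite F1, !Rminus_0_r in X. apply X.
      1,2 : simpl; lra.
      all : rewrite ?Rminus_diag; auto. now replace (a + eps - a) with eps by ring.
    + pose proof (Huf b y t (b - eps) y t) as X. rewrite F2, !Rminus_0_r in X. apply X.
      1,2 : simpl; lra.
      all : rewrite ?Rminus_diag; auto. replace (b - eps - b) with (- eps) by ring. now rewrite Rabs_Ropp.
  - intros s Hs. destruct (Hg s t) as [F1 F2]; try lra. split; left.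
    + pose proof (Hug s 0 t s eps t) as X. rewrite F1, !Rminus_0_r in X. apply X.
      1,2 : simpl; lra.
      all : rewrite ?Rminus_diag; auto.
    + pose proof (Hug s PI t s (PI - eps) t) as X. rewrite F2, !Rminus_0_r in X. apply X.
      1,2 : simpl; lra.
      all : rewrite ?Rminus_diag; auto. replace (PI - eps - PI) with (- eps) by ring. now rewrite Rabs_Ropp.
  - exists l. split; [exact Hl |]. eapply Rle_trans; [exact Hle |].
    apply Rmult_le_compat_l; lra. }
assert (Hps : forall y t, 0 < y < PI -> 0 < t < T -> forall s, a < s < b -> continuous (fun s => p (s, y, t)) s).
{ intros y t Hy Ht s Hs. apply (continuous_point p (fun s => s) (fun _ => y) (fun _ => t)).
  apply Hc; repeat split; lra. apply continuous_id. apply continuous_const. apply continuous_const. }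
assert (Hpy : forall t, 0 < t < T -> forall y, 0 < y < PI ->
  continuous (fun y => RInt (fun s => p (s, y, t)) (a + eps) (b - eps)) y).
{ intros t Ht y Hy.
  apply (continuous_RInt_param (fun y => 0 < y < PI) (fun s y => p (s, y, t))); try lra.
  exact (open_strict_between 0 PI).
  intros s y' Hs Hy'. apply (continuous_point p (fun q => fst q) (fun q => snd q) (fun _ => t)).
  apply Hc; simpl; repeat split; lra. apply continuous_fst. apply continuous_snd. apply continuous_const. }
assert (HE1 : E eps <= eta * ((b - a) * PI)).
{ assert (Hpe : forall s y, a < s < b -> 0 < y < PI -> p (s, y, eps) <= eta).
  { intros s y Hs Hy. pose proof (Hup s y 0 s y eps) as X.
    rewrite Hinit, !Rminus_0_r in X by auto.
    apply Rle_trans with (1 := Rle_abs _). left. apply X.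
    1,2 : simpl; lra.
    all : rewrite ?Rminus_diag, ?Rminus_0_r; auto. }
  assert (Hex : forall y, 0 < y < PI -> ex_RInt (fun s => p (s, y, eps)) (a + eps) (b - eps)).
  { intros y Hy. apply @ex_RInt_continuous. rewrite Rmin_left, Rmax_right by lra.
    intros s Hs. apply Hps; lra. }
  assert (Hi : forall y, 0 < y < PI -> RInt (fun s => p (s, y, eps)) (a + eps) (b - eps) <= (b - a) * eta).
  { intros y Hy. apply Rle_trans with (RInt (fun _ => eta) (a + eps) (b - eps)).
    - apply RInt_le; auto; try lra. apply ex_RInt_const. intros s Hs. apply Hpe; lra.
    - rewrite RInt_const. change (scal (b - eps - (a + eps)) eta) with ((b - eps - (a + eps)) * eta).
      apply Rmult_le_compat_r; lra. }
  apply Rle_trans with (RInt (fun _ => (b - a) * eta) eps (PI - eps)).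
  - apply RInt_le; auto; try lra.
    + apply @ex_RInt_continuous. rewrite Rmin_left, Rmax_right by lra. intros y Hy. apply Hpy; lra.
    + apply ex_RInt_const.
    + intros y Hy. apply Hi; lra.
  - rewrite RInt_const. change (scal (PI - eps - eps) ((b - a) * eta)) with ((PI - eps - eps) * ((b - a) * eta)).
    replace (eta * ((b - a) * PI)) with (PI * ((b - a) * eta)) by ring.
    apply Rmult_le_compat_r; try lra. apply Rmult_le_pos; lra. }
assert (HE2 : m <= E t2).
{ unfold m, E.
  replace (2 * r * (2 * r * (m0 / 2))) with (((y0 + r) - (y0 - r)) * (((s0 + r) - (s0 - r)) * (m0 / 2))) by ring.
  apply RInt_ge_subinterval; try lra.
  - intros y Hy. apply Hpy; lra.
  - intros y Hy. apply RInt_ge_0; try lra.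
    + apply @ex_RInt_continuous. rewrite Rmin_left, Rmax_right by lra. intros s Hs. apply Hps; lra.
    + intros s Hs. apply Hp0. repeat split; lra.
  - intros y Hy. apply RInt_ge_subinterval; try lra.
    + intros s Hs. apply Hps; lra.
    + intros s Hs. apply Hp0. repeat split; lra.
    + intros s Hs. apply Hpr; auto. }
assert (HD : forall t, 0 < t <= t2 -> is_derive E t (Derive E t) /\ Derive E t <= 2 * eta * ((b - a) + PI)).
{ intros t Ht. destruct (HE t Ht) as (l & Hl & Hle).
  rewrite (is_derive_unique _ _ _ Hl). auto. }
destruct (MVT_gen E eps t2 (Derive E)) as (xi & Hxi & Heq).
- rewrite Rmin_left, Rmax_right by lra. intros t Ht. apply HD; lra.
- rewrite Rmin_left, Rmax_right by lra. intros t Ht. apply continuity_pt_filterlim.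
  apply (ex_derive_continuous (K := R_AbsRing) (V := R_NormedModule) E). eexists. apply HD. lra.
- rewrite Rmin_left, Rmax_right in Hxi by lra.
  destruct (HD xi ltac:(lra)) as [_ Hxd].
  assert (X : Derive E xi * (t2 - eps) <= 2 * eta * ((b - a) + PI) * t2).
  { apply Rle_trans with (2 * eta * ((b - a) + PI) * (t2 - eps)).
    - apply Rmult_le_compat_r; lra.
    - apply Rmult_le_compat_l; [| lra]. apply Rmult_le_pos; lra. }
  assert (Y : eta * K = m / 2) by (unfold eta; field; lra).
  unfold K in Y. nra.
Qed.

(** * Rules for derivatives and for continuity on a set *)

Lemma is_derive_eq (f : R -> R) (x l l' : R) : is_derive f x l -> l = l' -> is_derive f x l'.
Proof. now intros H <-. Qed.

Lemma is_derive_Rmult (f g : R -> R) (x l m : R) :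
  is_derive f x l -> is_derive g x m -> is_derive (fun x => f x * g x) x (l * g x + f x * m).
Proof. intros Hf Hg. apply (is_derive_mult f g x l m Hf Hg). exact Rmult_comm. Qed.

Lemma is_derive_Rplus (f g : R -> R) (x l m : R) :
  is_derive f x l -> is_derive g x m -> is_derive (fun x => f x + g x) x (l + m).
Proof. exact (is_derive_plus (K := R_AbsRing) (V := R_NormedModule) f g x l m). Qed.

Lemma continuous_Rmult {U : UniformSpace} (f g : U -> R) (q : U) :
  continuous f q -> continuous g q -> continuous (fun q => f q * g q) q.
Proof. exact (continuous_mult (K := R_AbsRing) f g q). Qed.

Lemma continuous_Rplus {U : UniformSpace} (f g : U -> R) (q : U) :
  continuous f q -> continuous g q -> continuous (fun q => f q + g q) q.
Proof. exact (continuous_plus (K := R_AbsRing) (V := R_NormedModule) f g q). Qed.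

Lemma continuous_on_Rmult {U : UniformSpace} (D : U -> Prop) (f g : U -> R) :
  continuous_on D f -> continuous_on D g -> continuous_on D (fun q => f q * g q).
Proof.
intros Hf Hg q Hq. eapply filterlim_comp_2; [apply (Hf q Hq) | apply (Hg q Hq) |].
exact (filterlim_mult (K := R_AbsRing) (f q) (g q)).
Qed.

Lemma continuous_on_Rplus {U : UniformSpace} (D : U -> Prop) (f g : U -> R) :
  continuous_on D f -> continuous_on D g -> continuous_on D (fun q => f q + g q).
Proof.
intros Hf Hg q Hq. eapply filterlim_comp_2; [apply (Hf q Hq) | apply (Hg q Hq) |].
exact (filterlim_plus (K := R_AbsRing) (V := R_NormedModule) (f q) (g q)).
Qed.

Lemma continuous_on_continuous {U V : UniformSpace} (D : U -> Prop) (f : U -> V) :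
  (forall q, continuous f q) -> continuous_on D f.
Proof. intros Hf q _.
intros P HP. generalize (Hf q P HP). unfold within, filtermap. apply filter_imp. auto. Qed.

Lemma continuous_on_subset {U V : UniformSpace} (D D' : U -> Prop) (f : U -> V) :
  (forall q, D' q -> D q) -> continuous_on D f -> continuous_on D' f.
Proof.
intros HDD Hf q Hq P HP. generalize (Hf q (HDD q Hq) P HP).
unfold within, filtermap. apply filter_imp. auto.
Qed.

(** * Jets of solutions, weights and the weighted energy estimate *)

(** A function with its derivatives; [jxt] and [jyt] stand for both orders of the mixed
    derivatives. *)
Record jet : Type := Jet {
  j0 : point -> R; jx : point -> R; jy : point -> R; jt : point -> R;
  jxx : point -> R; jyy : point -> R; jtt : point -> R; jxt : point -> R; jyt : point -> R
}.

Definition slab (a b T : R) : point -> Prop :=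
  fun '(s, y, t) => a <= s <= b /\ 0 <= y <= PI /\ 0 <= t < T.

(** Side and initial conditions are recorded for the derivatives, in which the energy is written,
    and the delayed term stands on the right as a source. Detached from the strip index, the record
    is stable under reflections and sums. *)
Record solution_jet (c tau lam T a b : R) (j : jet) : Prop := {
  jet_cont : continuous_on (slab a b T) (j0 j) /\ continuous_on (slab a b T) (jx j) /\
    continuous_on (slab a b T) (jy j) /\ continuous_on (slab a b T) (jt j);
  jet_cont2 : forall z, open_box a b T z ->
    continuous (jx j) z /\ continuous (jy j) z /\ continuous (jt j) z /\
    continuous (jxx j) z /\ continuous (jyy j) z /\ continuous (jtt j) z /\
    continuous (jxt j) z /\ continuous (jyt j) z;
  jet_dt : forall s y t, a < s < b -> 0 < y < PI -> 0 <= t < T ->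
    is_derive (fun t => j0 j (s, y, t)) t (jt j (s, y, t));
  jet_d2 : forall s y t, open_box a b T (s, y, t) ->
    is_derive (fun s => jx j (s, y, t)) s (jxx j (s, y, t)) /\
    is_derive (fun t => jx j (s, y, t)) t (jxt j (s, y, t)) /\
    is_derive (fun y => jy j (s, y, t)) y (jyy j (s, y, t)) /\
    is_derive (fun t => jy j (s, y, t)) t (jyt j (s, y, t)) /\
    is_derive (fun s => jt j (s, y, t)) s (jxt j (s, y, t)) /\
    is_derive (fun y => jt j (s, y, t)) y (jyt j (s, y, t)) /\
    is_derive (fun t => jt j (s, y, t)) t (jtt j (s, y, t));
  jet_wave : forall s y t, open_box a b T (s, y, t) ->
    jtt j (s, y, t) - c ^ 2 * (jxx j (s, y, t) + jyy j (s, y, t)) = lam * j0 j (s, y, t - tau);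
  jet_history : forall s y t, a < s < b -> 0 < y < PI -> - tau <= t <= 0 -> j0 j (s, y, t) = 0;
  jet_init : forall s y, a < s < b -> 0 < y < PI ->
    jx j (s, y, 0) = 0 /\ jy j (s, y, 0) = 0 /\ jt j (s, y, 0) = 0;
  jet_sides : forall s t, a < s < b -> 0 < t < T -> jt j (s, 0, t) = 0 /\ jt j (s, PI, t) = 0
}.

(** The last condition lets the decay of [chi] absorb the spatial flux, which is at most
    [c] times the energy density. *)
Record weight (c : R) (chi chis chit : R -> R -> R) : Prop := {
  weight_ge0 : forall s t, 0 <= chi s t;
  weight_decr : forall s t t', t' <= t -> chi s t <= chi s t';
  weight_ds : forall s t, is_derive (fun s => chi s t) s (chis s t);
  weight_dt : forall s t, is_derive (fun t => chi s t) t (chit s t);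
  weight_cont : forall q : R * R, continuous (fun q => chi (fst q) (snd q)) q /\
    continuous (fun q => chis (fst q) (snd q)) q /\ continuous (fun q => chit (fst q) (snd q)) q;
  weight_cone : forall s t, chit s t + c * Rabs (chis s t) <= 0
}.

Ltac cont := lazymatch goal with
  | |- continuous (fun x => _ + _) _ => apply @continuous_Rplus; cont
  | |- continuous (fun x => _ * _) _ => apply @continuous_Rmult; cont
  | |- continuous (fun x => ?k) _ => first [assumption | apply continuous_const]
  | |- _ => assumption
  end.
Ltac conton := lazymatch goal with
  | |- continuous_on _ (fun x => _ + _) => apply @continuous_on_Rplus; conton
  | |- continuous_on _ (fun x => _ * _) => apply @continuous_on_Rmult; conton
  | |- continuous_on _ (fun x => ?k) => apply continuous_on_continuous; intros; apply continuous_const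
  | |- _ => first [assumption | auto]
  end.
Lemma is_derive_energy_density (k x : R) (X u v w : R -> R) (X' u' v' w' : R) :
  is_derive X x X' -> is_derive u x u' -> is_derive v x v' -> is_derive w x w' ->
  is_derive (fun x => X x * (u x * u x + k * (v x * v x + w x * w x))) x
    (X' * (u x * u x + k * (v x * v x + w x * w x))
     + X x * (2 * (u x * u') + 2 * k * (v x * v' + w x * w'))).
Proof.
intros HX Hu Hv Hw. eapply is_derive_eq.
- apply is_derive_Rmult; [exact HX |].
  apply (is_derive_Rplus (fun x => u x * u x)); [exact (is_derive_Rmult u u _ _ _ Hu Hu) |].
  apply (is_derive_scal (fun x => v x * v x + w x * w x)).
  apply (is_derive_Rplus (fun x => v x * v x) (fun x => w x * w x)); [exact (is_derive_Rmult v v _ _ _ Hv Hv) | exact (is_derive_Rmult w w _ _ _ Hw Hw)].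
- simpl. ring.
Qed.

Lemma is_derive_flux (k x : R) (X u v : R -> R) (X' u' v' : R) :
  is_derive X x X' -> is_derive u x u' -> is_derive v x v' ->
  is_derive (fun x => k * (X x * (u x * v x))) x
    (k * (X' * (u x * v x) + X x * (u' * v x + u x * v'))).
Proof.
intros HX Hu Hv. apply (is_derive_scal (fun x => X x * (u x * v x))).
apply (is_derive_Rmult X (fun x => u x * v x)); [exact HX | now apply is_derive_Rmult].
Qed.

(** Multiplying the wave equation by $2\chi u_t$ gives a balance law for the density $\chi\,(u_t^2 +
    c^2(u_x^2+u_y^2))$. Its source vanishes everywhere: where [chi] is positive because the delayed
    value is zero, elsewhere because of the factor [chi]. *)
Lemma weighted_energy_step (c tau lam T a b T2 : R) (j : jet) (chi chis chit : R -> R -> R) :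
  0 < c -> 0 < tau -> T2 <= T -> solution_jet c tau lam T a b j -> weight c chi chis chit ->
  (forall y t, 0 < y < PI -> 0 < t < T2 ->
     chi a t * (jx j (a, y, t) * jt j (a, y, t)) = 0 /\
     chi b t * (jx j (b, y, t) * jt j (b, y, t)) = 0) ->
  (forall s y t, open_box a b T2 (s, y, t) -> 0 < chi s t -> j0 j (s, y, t - tau) = 0) ->
  forall s y t, open_box a b T2 (s, y, t) -> 0 < chi s t -> j0 j (s, y, t) = 0.
Proof.
intros Hc Htau HT2 Hj Hw Hbd Hdelay.
set (X := fun z : point => chi (fst (fst z)) (snd z)).
set (Xs := fun z : point => chis (fst (fst z)) (snd z)).
set (Xt := fun z : point => chit (fst (fst z)) (snd z)).
assert (HXc : forall z, continuous X z /\ continuous Xs z /\ continuous Xt z).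
{ intros [[s y] t]. destruct (weight_cont _ _ _ _ Hw (s, t)) as (w1 & w2 & w3).
  assert (Hq : continuous (fun z : point => (fst (fst z), snd z)) (s, y, t)).
  { apply @continuous_pair; [apply (continuous_comp fst fst); apply continuous_fst | apply continuous_snd]. }
  repeat split; apply (continuous_comp (fun z : point => (fst (fst z), snd z))
    (fun q => _ (fst q) (snd q)) _ Hq); assumption. }
assert (HXon : forall D, continuous_on D X).
{ intros D. apply continuous_on_continuous. apply HXc. }
assert (Hsub : forall z, open_box a b T2 z -> open_box a b T z).
{ intros [[s y] t] (h1 & h2 & h3). repeat split; lra. }
assert (Hkey : forall s y t, open_box a b T2 (s, y, t) -> 0 < chi s t -> jt j (s, y, t) = 0).
{ intros s0 y0 t0 H0 Hchi.
  pose (p := fun z => X z * (jt j z * jt j z + (c ^ 2) * (jx j z * jx j z + jy j z * jy j z))).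
  pose (pt := fun z => Xt z * (jt j z * jt j z + (c ^ 2) * (jx j z * jx j z + jy j z * jy j z))
     + X z * (2 * (jt j z * jtt j z) + 2 * (c ^ 2) * (jx j z * jxt j z + jy j z * jyt j z))).
  pose (f := fun z => - 2 * c ^ 2 * (X z * (jx j z * jt j z))).
  pose (fs := fun z => - 2 * c ^ 2 * (Xs z * (jx j z * jt j z)
     + X z * (jxx j z * jt j z + jx j z * jxt j z))).
  pose (g := fun z => - 2 * c ^ 2 * (X z * (jy j z * jt j z))).
  pose (gy := fun z => - 2 * c ^ 2 * (X z * (jyy j z * jt j z + jy j z * jyt j z))).
  assert (Hp0 : p (s0, y0, t0) = 0).
  { apply (energy_vanishes a b T2 p pt f fs g gy).
    - intros z Hz. destruct (HXc z) as (w1 & w2 & w3).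
      destruct (jet_cont2 _ _ _ _ _ _ _ Hj z (Hsub z Hz)) as (k1 & k2 & k3 & k4 & k5 & k6 & k7 & k8).
      unfold p, pt, f, fs, g, gy. repeat apply conj; cont.
    - intros s y t Hz.
      destruct (jet_d2 _ _ _ _ _ _ _ Hj s y t (Hsub _ Hz)) as (k1 & k2 & k3 & k4 & k5 & k6 & k7).
      pose proof (weight_ds _ _ _ _ Hw s t) as w1. pose proof (weight_dt _ _ _ _ Hw s t) as w2.
      unfold p, pt, f, fs, g, gy, X, Xs, Xt; simpl fst; simpl snd. split; [| split].
      + exact (is_derive_energy_density (c ^ 2) t (fun t => chi s t) (fun t => jt j (s, y, t))
          (fun t => jx j (s, y, t)) (fun t => jy j (s, y, t)) _ _ _ _ w2 k7 k2 k4).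
      + exact (is_derive_flux (- 2 * c ^ 2) s (fun s => chi s t) (fun s => jx j (s, y, t))
          (fun s => jt j (s, y, t)) _ _ _ w1 k1 k5).
      + assert (w0 : is_derive (fun _ : R => chi s t) y 0)
          by exact (is_derive_const (K := R_AbsRing) (V := R_NormedModule) _ _).
        eapply is_derive_eq.
        * exact (is_derive_flux (- 2 * c ^ 2) y (fun _ => chi s t) (fun y => jy j (s, y, t))
            (fun y => jt j (s, y, t)) _ _ _ w0 k3 k6).
        * cbv beta. ring.
    - pose proof (jet_cont _ _ _ _ _ _ _ Hj) as (k1 & k2 & k3 & k4).
      assert (Hcb : forall z, closed_box a b 0 PI 0 t0 z -> slab a b T z).
      { destruct H0 as (h1 & h2 & h3). intros [[s y] t] (g1 & g2 & g3). repeat split; lra. }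
      apply (continuous_on_subset _ _ _ Hcb) in k2, k3, k4.
      unfold p; conton.
    - pose proof (jet_cont _ _ _ _ _ _ _ Hj) as (k1 & k2 & k3 & k4).
      assert (Hcb : forall z, closed_box a b 0 PI 0 t0 z -> slab a b T z).
      { destruct H0 as (h1 & h2 & h3). intros [[s y] t] (g1 & g2 & g3). repeat split; lra. }
      apply (continuous_on_subset _ _ _ Hcb) in k2, k3, k4.
      unfold f; conton.
    - pose proof (jet_cont _ _ _ _ _ _ _ Hj) as (k1 & k2 & k3 & k4).
      assert (Hcb : forall z, closed_box a b 0 PI 0 t0 z -> slab a b T z).
      { destruct H0 as (h1 & h2 & h3). intros [[s y] t] (g1 & g2 & g3). repeat split; lra. }
      apply (continuous_on_subset _ _ _ Hcb) in k2, k3, k4.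
      unfold g; conton.
    - intros z Hz. unfold p. apply Rmult_le_pos; [apply (weight_ge0 _ _ _ _ Hw) |]. nra.
    - intros [[s y] t] Hz.
      set (z := (s, y, t)).
      assert (Hwave : X z * (jt j z * (jtt j z - c ^ 2 * (jxx j z + jyy j z))) = 0).
      { destruct (weight_ge0 _ _ _ _ Hw s t) as [Hpos | Hz0].
        - unfold z. rewrite (jet_wave _ _ _ _ _ _ _ Hj s y t (Hsub _ Hz)), Hdelay by auto. ring.
        - unfold X, z; simpl. rewrite <- Hz0. ring. }
      assert (Hcone := weight_cone _ _ _ _ Hw s t).
      change (Xt z + c * Rabs (Xs z) <= 0) in Hcone.
      set (e := jt j z * jt j z + c ^ 2 * (jx j z * jx j z + jy j z * jy j z)).
      replace (pt z + fs z + gy z) with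
        (Xt z * e - 2 * c ^ 2 * (Xs z * (jx j z * jt j z))
         + 2 * (X z * (jt j z * (jtt j z - c ^ 2 * (jxx j z + jyy j z)))))
        by (unfold pt, fs, gy, e; ring).
      rewrite Hwave.
      assert (He0 : 0 <= e) by (unfold e; nra).
      assert (H1 : Xt z * e <= - (c * Rabs (Xs z)) * e) by (apply Rmult_le_compat_r; lra).
      assert (H2 : - (2 * c ^ 2 * (Xs z * (jx j z * jt j z))) <=
                   c * Rabs (Xs z) * (2 * (c * Rabs (jx j z) * Rabs (jt j z)))).
      { apply Rle_trans with (1 := Rle_abs _). rewrite Rabs_Ropp, !Rabs_mult.
        rewrite (Rabs_right 2), (Rabs_right (c ^ 2)) by nra. right. ring. }
      (* This is the square of $|u_t| - c|u_x|$ being nonnegative; the $u_y$ term of [e] only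
         helps. *)
      assert (H3 : 2 * (c * Rabs (jx j z) * Rabs (jt j z)) <= e).
      { unfold e.
        assert (E1 : jt j z * jt j z = Rabs (jt j z) * Rabs (jt j z)) by (rewrite <- Rabs_mult, Rabs_right; nra).
        assert (E2 : jx j z * jx j z = Rabs (jx j z) * Rabs (jx j z)) by (rewrite <- Rabs_mult, Rabs_right; nra).
        rewrite E1, E2. pose proof (Rle_0_sqr (Rabs (jt j z) - c * Rabs (jx j z))). unfold Rsqr in H.
        assert (0 <= c ^ 2 * (jy j z * jy j z)) by (apply Rmult_le_pos; nra). nra. }
      assert (H4 : c * Rabs (Xs z) * (2 * (c * Rabs (jx j z) * Rabs (jt j z))) <= c * Rabs (Xs z) * e).
      { apply Rmult_le_compat_l; [| exact H3]. apply Rmult_le_pos; [lra | apply Rabs_pos]. }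
      lra.
    - intros y t Hy Ht. destruct (Hbd y t Hy Ht) as [h1 h2]. unfold f, X; simpl fst; simpl snd.
      rewrite h1, h2. lra.
    - intros s t Hs Ht. destruct (jet_sides _ _ _ _ _ _ _ Hj s t Hs ltac:(lra)) as [h1 h2].
      unfold g. rewrite h1, h2. lra.
    - intros s y Hs Hy. destruct (jet_init _ _ _ _ _ _ _ Hj s y Hs Hy) as (h1 & h2 & h3).
      unfold p. rewrite h1, h2, h3. ring.
    - exact H0. }
  unfold p in Hp0. apply Rmult_integral in Hp0. destruct Hp0 as [Hp0 | Hp0].
  - unfold X in Hp0; simpl in Hp0. lra.
  - apply Rsqr_0_uniq. unfold Rsqr.
    assert (0 <= c ^ 2 * (jx j (s0, y0, t0) * jx j (s0, y0, t0) + jy j (s0, y0, t0) * jy j (s0, y0, t0)))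
      by (apply Rmult_le_pos; nra). nra. }
intros s y t (Hs & Hy & Ht) Hchi.
(* Earlier times at the same place have at least the same weight, so [jt] vanishes on the whole
   segment down to time 0, where the history gives the value 0. *)
destruct (MVT_gen (fun t => j0 j (s, y, t)) 0 t (fun t => jt j (s, y, t))) as (xi & Hxi & Heq).
- rewrite Rmin_left, Rmax_right by lra. intros t' Ht'. apply (jet_dt _ _ _ _ _ _ _ Hj); lra.
- rewrite Rmin_left, Rmax_right by lra. intros t' Ht'. apply continuity_pt_filterlim.
  apply (ex_derive_continuous (K := R_AbsRing) (V := R_NormedModule) (fun t => j0 j (s, y, t))).
  eexists. apply (jet_dt _ _ _ _ _ _ _ Hj); lra.
- rewrite Rmin_left, Rmax_right in Hxi by lra.
  assert (Hjt : jt j (s, y, xi) = 0).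
  { destruct (Rle_lt_or_eq_dec 0 xi (proj1 Hxi)) as [Hp | <-].
    - apply Hkey; [repeat split; lra |]. apply Rlt_le_trans with (1 := Hchi). now apply (weight_decr _ _ _ _ Hw).
    - now apply (jet_init _ _ _ _ _ _ _ Hj). }
  rewrite Hjt in Heq. rewrite (jet_history _ _ _ _ _ _ _ Hj s y 0) in Heq; auto; lra.
Qed.

(** Induction on the number of delay lengths. Since [chi] decreases in time, a point of positive
    weight keeps positive weight when moved back by [tau]; there the previous step applies, or the
    history when [t - tau] is not positive. The wave energy alone therefore suffices, without a
    growth estimate in [lam]. *)
Lemma weighted_energy (c tau lam T a b T1 : R) (j : jet) (chi chis chit : R -> R -> R) :
  0 < c -> 0 < tau -> T1 <= T -> solution_jet c tau lam T a b j -> weight c chi chis chit ->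
  (forall y t, 0 < y < PI -> 0 < t < T1 ->
     chi a t * (jx j (a, y, t) * jt j (a, y, t)) = 0 /\
     chi b t * (jx j (b, y, t) * jt j (b, y, t)) = 0) ->
  forall s y t, open_box a b T1 (s, y, t) -> 0 < chi s t -> j0 j (s, y, t) = 0.
Proof.
intros Hc Htau HT1 Hj Hw Hbd.
assert (Hn : forall n s y t, open_box a b (Rmin T1 (INR n * tau)) (s, y, t) -> 0 < chi s t ->
  j0 j (s, y, t) = 0).
{ induction n as [| n IH]; intros s y t Hz Hchi.
  - destruct Hz as (_ & _ & Hz). simpl in Hz. pose proof (Rmin_r T1 (0 * tau)). lra.
  - rewrite S_INR in *. pose proof (Rmin_l T1 ((INR n + 1) * tau)). pose proof (Rmin_r T1 ((INR n + 1) * tau)).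
    apply (weighted_energy_step c tau lam T a b (Rmin T1 ((INR n + 1) * tau)) j chi chis chit); auto.
    + lra.
    + intros y' t' Hy' Ht'. apply Hbd; lra.
    + intros s' y' t' (g1 & g2 & g3) Hchi'.
      destruct (Rle_dec (t' - tau) 0) as [Hle | Hgt].
      * apply (jet_history _ _ _ _ _ _ _ Hj); auto; lra.
      * apply IH.
        -- repeat split; try lra. apply Rmin_glb_lt; [lra |]. lra.
        -- apply Rlt_le_trans with (1 := Hchi'). apply (weight_decr _ _ _ _ Hw). lra. }
intros s y t (h1 & h2 & h3) Hchi.
destruct (INR_archimed tau t Htau) as [n Hlt].
apply (Hn n); auto. repeat split; try lra. apply Rmin_glb_lt; lra.
Qed.

(** * The constant weight and the cone weight: uniqueness and finite speed *)

Lemma weight_one (c : R) : weight c (fun _ _ => 1) (fun _ _ => 0) (fun _ _ => 0).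
Proof.
split; intros; try lra.
- apply (is_derive_const (K := R_AbsRing) (V := R_NormedModule)).
- apply (is_derive_const (K := R_AbsRing) (V := R_NormedModule)).
- repeat split; apply continuous_const.
- rewrite Rabs_R0. lra.
Qed.

Lemma continuous_Rmax0 (z : R) : continuous (Rmax 0) z.
Proof.
apply (continuous_ext (fun z => (z + Rabs z) / 2)).
- intros x. unfold Rmax, Rabs. destruct (Rle_dec 0 x), (Rcase_abs x); lra.
- unfold Rdiv. apply @continuous_Rmult; [| apply continuous_const].
  apply @continuous_Rplus; [apply continuous_id |]. apply continuous_Rabs.
Qed.

(** Squaring removes the corner of the positive part: at 0 the increment is at most $h^2$. This is
    why the cone weight is a square. *)
Lemma is_derive_Rmax0_sqr (z : R) : is_derive (fun z => Rmax 0 z * Rmax 0 z) z (2 * Rmax 0 z).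
Proof.
destruct (Rtotal_order z 0) as [Hz | [-> | Hz]].
- rewrite Rmax_left by lra. rewrite Rmult_0_r.
  apply (is_derive_ext_loc (fun _ => 0)).
  + generalize (open_lt 0 z Hz). apply filter_imp. intros x Hx.
    rewrite Rmax_left by lra. symmetry. apply Rmult_0_l.
  + apply (is_derive_const (K := R_AbsRing) (V := R_NormedModule)).
- rewrite Rmax_left by lra. rewrite Rmult_0_r. split; [apply is_linear_scal_l |].
  intros x Hx eps. pose proof (is_filter_lim_locally_unique (K := R_AbsRing) (V := R_NormedModule) 0 x Hx). subst x.
  exists eps. intros h Hh. change (Rabs (h - 0) < eps) in Hh.
  change (Rabs (Rmax 0 h * Rmax 0 h - Rmax 0 0 * Rmax 0 0 - (h - 0) * 0) <= eps * Rabs (h - 0)).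
  rewrite Rminus_0_r in *. rewrite (Rmax_left 0 0) by lra.
  replace (Rmax 0 h * Rmax 0 h - 0 * 0 - h * 0) with (Rmax 0 h * Rmax 0 h) by ring.
  rewrite Rabs_mult.
  assert (Rabs (Rmax 0 h) <= Rabs h).
  { unfold Rmax. destruct (Rle_dec 0 h). lra. rewrite Rabs_R0. apply Rabs_pos. }
  apply Rmult_le_compat; auto using Rabs_pos. lra.
- apply (is_derive_ext_loc (fun z => z * z)).
  + generalize (open_gt 0 z Hz). apply filter_imp. intros x Hx.
    now rewrite Rmax_right by lra.
  + rewrite Rmax_right by lra. auto_derive; auto. ring.
Qed.

(** A function of $s + ct$ alone has time derivative equal to [c] times its space derivative, and
    this one is nonincreasing, so the cone condition holds with equality. The edge of the support
    moves inwards along $s = r - ct$. *)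
Lemma weight_cone_tip (c r : R) : 0 < c ->
  weight c (fun s t => Rmax 0 (r - s - c * t) * Rmax 0 (r - s - c * t))
    (fun s t => - (2 * Rmax 0 (r - s - c * t))) (fun s t => - c * (2 * Rmax 0 (r - s - c * t))).
Proof.
intros Hc.
assert (Hcont : forall q : R * R, continuous (fun q : R * R => Rmax 0 (r - fst q - c * snd q)) q).
{ intros [s t]. apply (continuous_comp (fun q : R * R => r - fst q - c * snd q) (Rmax 0)); [| apply continuous_Rmax0].
  apply (continuous_minus (V := R_NormedModule)); [apply (continuous_minus (V := R_NormedModule)) |].
  - apply continuous_const.
  - apply continuous_fst.
  - apply @continuous_Rmult; [apply continuous_const | apply continuous_snd]. }
split; intros.
- apply Rle_0_sqr.
- assert (Rmax 0 (r - s - c * t) <= Rmax 0 (r - s - c * t')).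
  { apply Rle_max_compat_l. pose proof (Rmult_le_compat_l c t' t ltac:(lra) H). lra. }
  pose proof (Rmax_l 0 (r - s - c * t)). apply Rmult_le_compat; lra.
- eapply is_derive_eq.
  + apply (is_derive_comp (fun z => Rmax 0 z * Rmax 0 z) (fun s => r - s - c * t)).
    apply is_derive_Rmax0_sqr. auto_derive; auto.
  + change (scal ?x ?y) with (x * y). ring.
- eapply is_derive_eq.
  + apply (is_derive_comp (fun z => Rmax 0 z * Rmax 0 z) (fun t => r - s - c * t)).
    apply is_derive_Rmax0_sqr. auto_derive; auto.
  + change (scal ?x ?y) with (x * y). ring.
- repeat split.
  + apply @continuous_Rmult; apply Hcont.
  + apply (continuous_opp (V := R_NormedModule)). apply @continuous_Rmult; [apply continuous_const | apply Hcont].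
  + apply @continuous_Rmult; [apply continuous_const |]. apply @continuous_Rmult; [apply continuous_const | apply Hcont].
- rewrite Rabs_Ropp, Rabs_right. lra. pose proof (Rmax_l 0 (r - s - c * t)). lra.
Qed.

(** The constant weight is positive everywhere and needs only one vanishing factor of the flux on
    each face; which factor may even vary along the face. *)
Lemma mixed_uniqueness (c tau lam T a b T1 : R) (j : jet) :
  0 < c -> 0 < tau -> T1 <= T -> solution_jet c tau lam T a b j ->
  (forall y t, 0 < y < PI -> 0 < t < T1 ->
     (jx j (a, y, t) = 0 \/ jt j (a, y, t) = 0) /\ (jx j (b, y, t) = 0 \/ jt j (b, y, t) = 0)) ->
  forall s y t, open_box a b T1 (s, y, t) -> j0 j (s, y, t) = 0.
Proof.
intros Hc Htau HT1 Hj Hbd s y t Hz.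
apply (weighted_energy c tau lam T a b T1 j _ _ _ Hc Htau HT1 Hj (weight_one c)); auto; [| lra].
intros y' t' Hy' Ht'. destruct (Hbd y' t' Hy' Ht') as [[h1 | h1] [h2 | h2]]; rewrite h1, h2; split; ring.
Qed.

(** The cone weight vanishes on the face [s = b] from time [T0] on, so the trace there
    matters only before [T0]. *)
Lemma finite_speed (c tau lam T a b T0 : R) (j : jet) :
  0 < c -> 0 < tau -> solution_jet c tau lam T a b j ->
  (forall y t, 0 < y < PI -> 0 < t < T -> jx j (a, y, t) = 0) ->
  (forall y t, 0 < y < PI -> 0 < t < T -> t < T0 -> jt j (b, y, t) = 0) ->
  forall s y t, open_box a b T (s, y, t) -> s + c * (t - T0) < b -> j0 j (s, y, t) = 0.
Proof.
intros Hc Htau Hj Ha Hb s y t Hz Hcone.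
(* With [r = b + c * T0] the edge of the cone is at [s = b] exactly at time [T0]. *)
apply (weighted_energy c tau lam T a b T j _ _ _ Hc Htau (Rle_refl T) Hj
  (weight_cone_tip c (b + c * T0) Hc)); auto.
- intros y' t' Hy' Ht'. split.
  + rewrite Ha by auto. ring.
  + destruct (Rlt_dec t' T0) as [Hlt | Hge].
    * rewrite Hb by auto. ring.
    * rewrite Rmax_left. ring.
      pose proof (Rmult_le_compat_l c T0 t' ltac:(lra) ltac:(lra)). lra.
- rewrite Rmax_right by lra. apply Rmult_lt_0_compat; lra.
Qed.

(** * From classical solutions to jets *)

Lemma is_derive_within_interior (D : R -> Prop) (f : R -> R) (x l : R) :
  locally x D -> is_derive_within D f x l -> is_derive f x l.
Proof.
intros HD [Hlin H]. split; [exact Hlin |].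
intros z Hz eps.
assert (Hz' : is_filter_lim (within D (locally x)) z).
{ intros P HP. generalize (Hz P HP). unfold within. apply filter_imp. auto. }
generalize (filter_and _ _ HD (H z Hz' eps)). unfold within. apply filter_imp. tauto.
Qed.

(** At a limit point of the domain the derivative is determined, even if one-sided. This is what
    identifies the number [q] in [neumann] with the derivative stored in a jet. *)
Lemma is_derive_within_unique (D : R -> Prop) (f : R -> R) (x l m : R) :
  (forall d : posreal, exists z, D z /\ z <> x /\ Rabs (z - x) < d) ->
  is_derive_within D f x l -> is_derive_within D f x m -> l = m.
Proof.
intros Hacc [_ Hl] [_ Hm].
destruct (Req_dec l m) as [| Hlm]; [assumption | exfalso].
assert (He : 0 < Rabs (l - m) / 4) by (apply Rdiv_lt_0_compat; [apply Rabs_pos_lt; lra | lra]).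
assert (Hx : is_filter_lim (within D (locally x)) x).
{ intros P HP. unfold within. generalize HP. apply filter_imp. auto. }
specialize (Hl x Hx (mkposreal _ He)). specialize (Hm x Hx (mkposreal _ He)).
destruct (filter_and (F := within D (locally x)) _ _ Hl Hm) as [d Hd].
destruct (Hacc d) as (z & HDz & Hzx & Hz).
destruct (Hd z Hz HDz) as [h1 h2].
change (Rabs (f z - f x - (z - x) * l) <= Rabs (l - m) / 4 * Rabs (z - x)) in h1.
change (Rabs (f z - f x - (z - x) * m) <= Rabs (l - m) / 4 * Rabs (z - x)) in h2.
assert (H3 : Rabs ((z - x) * (l - m)) <= 2 * (Rabs (l - m) / 4 * Rabs (z - x))).
{ replace ((z - x) * (l - m)) with ((f z - f x - (z - x) * m) - (f z - f x - (z - x) * l)) by ring.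
  eapply Rle_trans; [apply Rabs_triang |]. rewrite Rabs_Ropp. lra. }
rewrite Rabs_mult in H3.
assert (0 < Rabs (z - x) * Rabs (l - m)) by (apply Rmult_lt_0_compat; apply Rabs_pos_lt; lra).
lra.
Qed.

Lemma continuous_on_interior {U V : UniformSpace} (D : U -> Prop) (f : U -> V) (q : U) :
  open D -> D q -> continuous_on D f -> continuous f q.
Proof.
intros HD Hq Hf P HP. generalize (filter_and _ _ (HD q Hq) (Hf q Hq P HP)).
unfold within, filtermap. apply filter_imp. tauto.
Qed.

Lemma continuous_on_comp {U V W : UniformSpace} (D : U -> Prop) (D' : V -> Prop) (g : U -> V) (f : V -> W) :
  (forall q, continuous g q) -> (forall q, D q -> D' (g q)) -> continuous_on D' f ->
  continuous_on D (fun q => f (g q)).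
Proof.
intros Hg HD Hf q Hq P HP. generalize (Hg q _ (Hf (g q) (HD q Hq) P HP)).
unfold within, filtermap. apply filter_imp. auto.
Qed.

Lemma open_open_box (a b T : R) : open (open_box a b T).
Proof.
intros [[s y] t] (Hs & Hy & Ht).
destruct (open_rectangle a b 0 PI (s, y) (conj Hs Hy)) as [d1 H1].
destruct (open_strict_between 0 T t Ht) as [d2 H2].
assert (Hd : 0 < Rmin d1 d2) by (apply Rmin_glb_lt; [apply d1 | apply d2]).
exists (mkposreal _ Hd). intros [[s' y'] t'] [h1 h2].
assert (g1 := H1 (s', y') (ball_le _ _ _ (Rmin_l d1 d2) _ h1)).
assert (g2 := H2 t' (ball_le _ _ _ (Rmin_r d1 d2) _ h2)).
simpl in *. tauto.
Qed.

(** [C2_on] supplies the derivative of $u_x$ in $t$ and that of $u_t$ in $x$ independently, while a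
    jet has one field for both. The Schwarz theorem speaks of iterated [Derive], hence the passage
    through local equalities. *)
Lemma mixed_partials (a b c d : R) (f fx fy fxy fyx : R -> R -> R) :
  (forall u v, a < u < b -> c < v < d ->
    is_derive (fun u => f u v) u (fx u v) /\ is_derive (fun v => f u v) v (fy u v) /\
    is_derive (fun v => fx u v) v (fxy u v) /\ is_derive (fun u => fy u v) u (fyx u v) /\
    continuous (fun q : R * R => fxy (fst q) (snd q)) (u, v) /\
    continuous (fun q : R * R => fyx (fst q) (snd q)) (u, v)) ->
  forall u v, a < u < b -> c < v < d -> fyx u v = fxy u v.
Proof.
intros H u0 v0 Hu0 Hv0.
assert (Hx : forall u v, a < u < b -> c < v < d ->
  is_derive (fun v => Derive (fun u => f u v) u) v (fxy u v)).
{ intros u v Hu Hv. apply (is_derive_ext_loc (fun v => fx u v)).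
  - generalize (open_strict_between c d v Hv). apply filter_imp. intros z Hz.
    symmetry. apply is_derive_unique. now apply H.
  - now apply H. }
assert (Hy : forall u v, a < u < b -> c < v < d ->
  is_derive (fun u => Derive (fun v => f u v) v) u (fyx u v)).
{ intros u v Hu Hv. apply (is_derive_ext_loc (fun u => fy u v)).
  - generalize (open_strict_between a b u Hu). apply filter_imp. intros z Hz.
    symmetry. apply is_derive_unique. now apply H.
  - now apply H. }
assert (Hloc : locally (u0, v0) (fun q : R * R => a < fst q < b /\ c < snd q < d)).
{ apply (open_rectangle a b c d). now split. }
transitivity (Derive (fun z => Derive (fun t => f z t) v0) u0).
{ symmetry. apply is_derive_unique. now apply Hy. }
transitivity (Derive (fun z => Derive (fun t => f t z) u0) v0).
2:{ apply is_derive_unique. now apply Hx. }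
apply Schwarz.
- apply locally_2d_locally. generalize Hloc. apply filter_imp. intros [u v] [Hu Hv]. simpl in Hu, Hv.
  destruct (H u v Hu Hv) as (h1 & h2 & _). simpl.
  split; [eexists; exact h1 |]. split; [eexists; exact h2 |].
  split; eexists; [apply Hy; auto | apply Hx; auto].
- apply continuity_2d_pt_filterlim.
  replace (Derive (fun z => Derive (fun t => f z t) v0) u0) with (fyx u0 v0).
  2:{ symmetry. apply is_derive_unique. now apply Hy. }
  apply (filterlim_ext_loc (fun q : R * R => fyx (fst q) (snd q))).
  + generalize Hloc. apply filter_imp. intros [u v] [Hu Hv]. symmetry. apply is_derive_unique. now apply Hy.
  + now apply H.
- apply continuity_2d_pt_filterlim.
  replace (Derive (fun z => Derive (fun t => f t z) u0) v0) with (fxy u0 v0).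
  2:{ symmetry. apply is_derive_unique. now apply Hx. }
  apply (filterlim_ext_loc (fun q : R * R => fxy (fst q) (snd q))).
  + generalize Hloc. apply filter_imp. intros [u v] [Hu Hv]. symmetry. apply is_derive_unique. now apply Hx.
  + now apply H.
Qed.

Lemma Derive_n_2 (f g : R -> R) (x l : R) :
  locally x (fun z => is_derive f z (g z)) -> is_derive g x l -> Derive_n f 2 x = l.
Proof.
intros Hf Hg. simpl. apply is_derive_unique. apply (is_derive_ext_loc g); [| exact Hg].
generalize Hf. apply filter_imp. intros z Hz. symmetry. now apply is_derive_unique.
Qed.

(** The derivative facts reach the closed cylinder because the interface conditions are read on its
    faces, where only one-sided derivatives in $x$ exist. *)
Record error_jet (c tau lam T : R) (x : nat -> R) (i : nat) (u : point -> R) (j : jet) : Prop := {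
  error_jet_solution : solution_jet c tau lam T (x (i - 1)%nat) (x i) j;
  error_jet_value : j0 j = u;
  error_jet_dx : forall s y t, closed_cyl x tau T i (s, y, t) ->
    dx_on (closed_cyl x tau T i) u s y t (jx j (s, y, t));
  error_jet_dt : forall s y t, closed_cyl x tau T i (s, y, t) ->
    dt_on (closed_cyl x tau T i) u s y t (jt j (s, y, t))
}.

Lemma error_solution_jet (c tau lam T : R) (x : nat -> R) (i : nat) (u : point -> R) :
  0 < tau -> 0 < T -> x (i - 1)%nat < x i -> error_solution c tau lam T x i u ->
  exists j, error_jet c tau lam T x i u j.
Proof.
intros Htau HT Hx Hu.
destruct (sol_C1 _ _ _ _ _ _ _ Hu) as (ux & uy & ut & H1).
destruct (sol_C2 _ _ _ _ _ _ _ Hu) as (vx & vy & vt & H2 & (uxx & uxy & uxt & Hxx) &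
  (uyx & uyy & uyt & Hyy) & (utx & uty & utt & Htt)).
set (a := x (i - 1)%nat) in *. set (b := x i) in *.
assert (Hin : forall s y t, open_box a b T (s, y, t) -> open_cyl x T i (s, y, t)).
{ intros s y t (h1 & h2 & h3). repeat split; tauto. }
assert (Hop : open (open_cyl x T i)).
{ intros [[s y] t] ((h1 & h2) & h3).
  generalize (open_open_box a b T (s, y, t) (conj h1 (conj h2 h3))). apply filter_imp.
  intros [[s' y'] t']. apply Hin. }
assert (Hcs : forall s y t, open_box a b T (s, y, t) -> locally s (fun s => open_box a b T (s, y, t))).
{ intros s y t (h1 & h2 & h3). generalize (open_strict_between _ _ s h1). apply filter_imp.
  intros; repeat split; tauto. }
assert (Hcy : forall s y t, open_box a b T (s, y, t) -> locally y (fun y => open_box a b T (s, y, t))).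
{ intros s y t (h1 & h2 & h3). generalize (open_strict_between _ _ y h2). apply filter_imp.
  intros; repeat split; tauto. }
assert (Hct : forall s y t, open_box a b T (s, y, t) -> locally t (fun t => open_box a b T (s, y, t))).
{ intros s y t (h1 & h2 & h3). generalize (open_strict_between _ _ t h3). apply filter_imp.
  intros; repeat split; tauto. }
assert (Hbc : forall s y t, open_box a b T (s, y, t) -> closed_cyl x tau T i (s, y, t)).
{ intros s y t (h1 & h2 & h3). repeat split; fold a; fold b; lra. }
assert (Dx : forall Q v vx' vy' vt', C1_with Q v vx' vy' vt' ->
  (forall s y t, open_box a b T (s, y, t) -> Q (s, y, t)) ->
  forall s y t, open_box a b T (s, y, t) ->
   is_derive (fun s => v (s, y, t)) s (vx' (s, y, t)) /\
   is_derive (fun y => v (s, y, t)) y (vy' (s, y, t)) /\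
   is_derive (fun t => v (s, y, t)) t (vt' (s, y, t))).
{ intros Q v vx' vy' vt' Hv HQ s y t Hz. split; [| split].
  - apply (is_derive_within_interior (fun s => Q (s, y, t))).
    + generalize (Hcs s y t Hz). apply filter_imp. auto.
    + apply (C1_dx _ _ _ _ _ Hv). auto.
  - apply (is_derive_within_interior (fun y => Q (s, y, t))).
    + generalize (Hcy s y t Hz). apply filter_imp. auto.
    + apply (C1_dy _ _ _ _ _ Hv). auto.
  - apply (is_derive_within_interior (fun t => Q (s, y, t))).
    + generalize (Hct s y t Hz). apply filter_imp. auto.
    + apply (C1_dt _ _ _ _ _ Hv). auto. }
assert (Hd1 := Dx _ _ _ _ _ H1 Hbc). assert (Hd2 := Dx _ _ _ _ _ H2 Hin).
assert (Hdx := Dx _ _ _ _ _ Hxx Hin). assert (Hdy := Dx _ _ _ _ _ Hyy Hin).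
assert (Hdt := Dx _ _ _ _ _ Htt Hin).
(* The two regularity assumptions come with separate first derivatives. They agree inside, so the
   jet can take those that are continuous up to the boundary and give them the second derivatives of
   the interior ones. *)
assert (Heq : forall s y t, open_box a b T (s, y, t) ->
  vx (s, y, t) = ux (s, y, t) /\ vy (s, y, t) = uy (s, y, t) /\ vt (s, y, t) = ut (s, y, t)).
{ intros s y t Hz. destruct (Hd1 s y t Hz) as (p1 & p2 & p3). destruct (Hd2 s y t Hz) as (q1 & q2 & q3).
  apply is_derive_unique in p1, p2, p3, q1, q2, q3. repeat split; congruence. }
assert (Hco : forall (Q : point -> Prop) (v : point -> R), continuous_on Q v -> open Q ->
  (forall s y t, open_box a b T (s, y, t) -> Q (s, y, t)) ->
  forall z, open_box a b T z -> continuous v z).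
{ intros Q v Hv HQ HbQ [[s y] t] Hz. apply (continuous_on_interior Q); auto. }
assert (Hxt : forall s y t, open_box a b T (s, y, t) -> utx (s, y, t) = uxt (s, y, t)).
{ intros s y t (h1 & h2 & h3).
  apply (mixed_partials a b 0 T (fun s t => u (s, y, t)) (fun s t => vx (s, y, t))
    (fun s t => vt (s, y, t)) (fun s t => uxt (s, y, t)) (fun s t => utx (s, y, t))); auto.
  intros s' t' Hs' Ht'. assert (Hz : open_box a b T (s', y, t')) by (repeat split; lra).
  split; [apply (Hd2 _ _ _ Hz) |]. split; [apply (Hd2 _ _ _ Hz) |].
  split; [apply (Hdx _ _ _ Hz) |]. split; [apply (Hdt _ _ _ Hz) |].
  split.
  - apply (continuous_point uxt (fun q => fst q) (fun _ => y) (fun q => snd q));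
    [| apply continuous_fst | apply continuous_const | apply continuous_snd].
    apply (Hco _ _ (C1_cont_t _ _ _ _ _ Hxx) Hop Hin _ Hz).
  - apply (continuous_point utx (fun q => fst q) (fun _ => y) (fun q => snd q));
    [| apply continuous_fst | apply continuous_const | apply continuous_snd].
    apply (Hco _ _ (C1_cont_x _ _ _ _ _ Htt) Hop Hin _ Hz). }
assert (Hyt : forall s y t, open_box a b T (s, y, t) -> uty (s, y, t) = uyt (s, y, t)).
{ intros s y t (h1 & h2 & h3).
  apply (mixed_partials 0 PI 0 T (fun y t => u (s, y, t)) (fun y t => vy (s, y, t))
    (fun y t => vt (s, y, t)) (fun y t => uyt (s, y, t)) (fun y t => uty (s, y, t))); auto.
  intros y' t' Hs' Ht'. assert (Hz : open_box a b T (s, y', t')) by (repeat split; lra).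
  split; [apply (Hd2 _ _ _ Hz) |]. split; [apply (Hd2 _ _ _ Hz) |].
  split; [apply (Hdy _ _ _ Hz) |]. split; [apply (Hdt _ _ _ Hz) |].
  split.
  - apply (continuous_point uyt (fun _ => s) (fun q => fst q) (fun q => snd q));
    [| apply continuous_const | apply continuous_fst | apply continuous_snd].
    apply (Hco _ _ (C1_cont_t _ _ _ _ _ Hyy) Hop Hin _ Hz).
  - apply (continuous_point uty (fun _ => s) (fun q => fst q) (fun q => snd q));
    [| apply continuous_const | apply continuous_fst | apply continuous_snd].
    apply (Hco _ _ (C1_cont_y _ _ _ _ _ Htt) Hop Hin _ Hz). }
assert (Hs0 : forall s y t, open_box a b T (s, y, t) ->
  is_derive (fun s => ux (s, y, t)) s (uxx (s, y, t)) /\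
  is_derive (fun t => ux (s, y, t)) t (uxt (s, y, t)) /\
  is_derive (fun y => uy (s, y, t)) y (uyy (s, y, t)) /\
  is_derive (fun t => uy (s, y, t)) t (uyt (s, y, t)) /\
  is_derive (fun s => ut (s, y, t)) s (uxt (s, y, t)) /\
  is_derive (fun y => ut (s, y, t)) y (uyt (s, y, t)) /\
  is_derive (fun t => ut (s, y, t)) t (utt (s, y, t))).
{ intros s y t Hz.
  destruct (Hdx _ _ _ Hz) as (k1 & _ & k2). destruct (Hdy _ _ _ Hz) as (_ & k3 & k4).
  destruct (Hdt _ _ _ Hz) as (k5 & k6 & k7).
  rewrite Hxt in k5 by exact Hz. rewrite Hyt in k6 by exact Hz.
  repeat match goal with |- _ /\ _ => split end.
  - apply (is_derive_ext_loc (fun s => vx (s, y, t))); [| exact k1].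
    generalize (Hcs _ _ _ Hz). apply filter_imp. intros; now apply Heq.
  - apply (is_derive_ext_loc (fun t => vx (s, y, t))); [| exact k2].
    generalize (Hct _ _ _ Hz). apply filter_imp. intros; now apply Heq.
  - apply (is_derive_ext_loc (fun y => vy (s, y, t))); [| exact k3].
    generalize (Hcy _ _ _ Hz). apply filter_imp. intros; now apply Heq.
  - apply (is_derive_ext_loc (fun t => vy (s, y, t))); [| exact k4].
    generalize (Hct _ _ _ Hz). apply filter_imp. intros; now apply Heq.
  - apply (is_derive_ext_loc (fun s => vt (s, y, t))); [| exact k5].
    generalize (Hcs _ _ _ Hz). apply filter_imp. intros; now apply Heq.
  - apply (is_derive_ext_loc (fun y => vt (s, y, t))); [| exact k6].
    generalize (Hcy _ _ _ Hz). apply filter_imp. intros; now apply Heq.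
  - apply (is_derive_ext_loc (fun t => vt (s, y, t))); [| exact k7].
    generalize (Hct _ _ _ Hz). apply filter_imp. intros; now apply Heq. }
assert (Hslab : forall z, slab a b T z -> closed_cyl x tau T i z).
{ intros [[s y] t] (h1 & h2 & h3). repeat split; fold a; fold b; lra. }
(* The history before time 0 makes every [t > - tau], in particular [t = 0], interior in time, even
   on the faces; the time derivative there is an ordinary one. *)
assert (Htfull : forall s y t, a <= s <= b -> 0 <= y <= PI -> - tau < t < T ->
   is_derive (fun t => u (s, y, t)) t (ut (s, y, t))).
{ intros s y t Hs Hy Ht. apply (is_derive_within_interior (fun t => closed_cyl x tau T i (s, y, t))).
  - generalize (open_strict_between _ _ t Ht). apply filter_imp. intros t' Ht'.
    repeat split; fold a; fold b; lra.
  - apply (C1_dt _ _ _ _ _ H1). repeat split; fold a; fold b; lra. }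
exists (Jet u ux uy ut uxx uyy utt uxt uyt).
split; [fold a b; split; simpl | reflexivity | exact (C1_dx _ _ _ _ _ H1) | exact (C1_dt _ _ _ _ _ H1)].
- repeat split; apply (continuous_on_subset _ _ _ Hslab); apply H1.
- assert (Hob : forall s y t, open_box a b T (s, y, t) -> open_box a b T (s, y, t)) by auto.
  assert (Hbs : forall z, open_box a b T z -> closed_cyl x tau T i z).
  { intros [[s y] t]. apply Hbc. }
  intros z Hz. repeat apply conj.
  + apply (Hco _ _ (continuous_on_subset _ _ _ Hbs (C1_cont_x _ _ _ _ _ H1)) (open_open_box a b T) Hob z Hz).
  + apply (Hco _ _ (continuous_on_subset _ _ _ Hbs (C1_cont_y _ _ _ _ _ H1)) (open_open_box a b T) Hob z Hz).
  + apply (Hco _ _ (continuous_on_subset _ _ _ Hbs (C1_cont_t _ _ _ _ _ H1)) (open_open_box a b T) Hob z Hz).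
  + apply (Hco _ _ (C1_cont_x _ _ _ _ _ Hxx) Hop Hin z Hz).
  + apply (Hco _ _ (C1_cont_y _ _ _ _ _ Hyy) Hop Hin z Hz).
  + apply (Hco _ _ (C1_cont_t _ _ _ _ _ Htt) Hop Hin z Hz).
  + apply (Hco _ _ (C1_cont_t _ _ _ _ _ Hxx) Hop Hin z Hz).
  + apply (Hco _ _ (C1_cont_t _ _ _ _ _ Hyy) Hop Hin z Hz).
- intros s y t Hs Hy Ht. apply Htfull; lra.
- exact Hs0.
- intros s y t Hz. destruct (Hs0 s y t Hz) as (k1 & k2 & k3 & k4 & k5 & k6 & k7).
  assert (Hstrip : in_strip x i s y) by (split; apply Hz).
  pose proof (sol_wave _ _ _ _ _ _ _ Hu s y t Hstrip (proj2 (proj2 Hz))) as W.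
  rewrite (Derive_n_2 (fun t => u (s, y, t)) (fun t => ut (s, y, t)) t (utt (s, y, t))) in W.
  rewrite (Derive_n_2 (fun s => u (s, y, t)) (fun s => ux (s, y, t)) s (uxx (s, y, t))) in W.
  rewrite (Derive_n_2 (fun y => u (s, y, t)) (fun y => uy (s, y, t)) y (uyy (s, y, t))) in W.
  + lra.
  + generalize (Hcy _ _ _ Hz). apply filter_imp. intros; now apply Hd1.
  + exact k3.
  + generalize (Hcs _ _ _ Hz). apply filter_imp. intros; now apply Hd1.
  + exact k1.
  + generalize (Hct _ _ _ Hz). apply filter_imp. intros; now apply Hd1.
  + exact k7.
- intros s y t Hs Hy Ht. now apply (sol_history _ _ _ _ _ _ _ Hu).
- intros s y Hs Hy.
  assert (Hz0 : closed_cyl x tau T i (s, y, 0)) by (repeat split; fold a; fold b; lra).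
  assert (Hh : forall s y, a < s < b -> 0 < y < PI -> u (s, y, 0) = 0).
  { intros s' y' Hs' Hy'. apply (sol_history _ _ _ _ _ _ _ Hu); [now split | lra]. }
  repeat apply conj.
  + rewrite <- (is_derive_unique (fun s => u (s, y, 0)) s (ux (s, y, 0))).
    * apply is_derive_unique. apply (is_derive_ext_loc (fun _ => 0)).
      -- generalize (open_strict_between _ _ s Hs). apply filter_imp. intros z Hz. symmetry. now apply Hh.
      -- apply (is_derive_const (K := R_AbsRing) (V := R_NormedModule)).
    * apply (is_derive_within_interior (fun s => closed_cyl x tau T i (s, y, 0))).
      -- generalize (open_strict_between _ _ s Hs). apply filter_imp. intros z Hz.
         repeat split; fold a; fold b; lra.
      -- now apply (C1_dx _ _ _ _ _ H1).
  + rewrite <- (is_derive_unique (fun y => u (s, y, 0)) y (uy (s, y, 0))).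
    * apply is_derive_unique. apply (is_derive_ext_loc (fun _ => 0)).
      -- generalize (open_strict_between _ _ y Hy). apply filter_imp. intros z Hz. symmetry. now apply Hh.
      -- apply (is_derive_const (K := R_AbsRing) (V := R_NormedModule)).
    * apply (is_derive_within_interior (fun y => closed_cyl x tau T i (s, y, 0))).
      -- generalize (open_strict_between _ _ y Hy). apply filter_imp. intros z Hz.
         repeat split; fold a; fold b; lra.
      -- now apply (C1_dy _ _ _ _ _ H1).
  + assert (Hd0 : dt_on (closed_cyl x tau T i) u s y 0 0).
    { apply (sol_history _ _ _ _ _ _ _ Hu); [now split | lra]. }
    rewrite <- (is_derive_unique (fun t => u (s, y, t)) 0 (ut (s, y, 0))) by (apply Htfull; lra).
    apply is_derive_unique.
    apply (is_derive_within_interior (fun t => closed_cyl x tau T i (s, y, t))); [| exact Hd0].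
    generalize (open_strict_between (- tau) T 0 ltac:(lra)). apply filter_imp. intros z Hz.
    repeat split; fold a; fold b; lra.
- intros s t Hs Ht. pose proof PI_RGT_0.
  split.
  + rewrite <- (is_derive_unique (fun t => u (s, 0, t)) t (ut (s, 0, t))) by (apply Htfull; lra).
    apply is_derive_unique. apply (is_derive_ext_loc (fun _ => 0)).
    * generalize (open_strict_between _ _ t Ht). apply filter_imp. intros z Hz. symmetry.
      now apply (sol_sides _ _ _ _ _ _ _ Hu).
    * apply (is_derive_const (K := R_AbsRing) (V := R_NormedModule)).
  + rewrite <- (is_derive_unique (fun t => u (s, PI, t)) t (ut (s, PI, t))) by (apply Htfull; lra).
    apply is_derive_unique. apply (is_derive_ext_loc (fun _ => 0)).
    * generalize (open_strict_between _ _ t Ht). apply filter_imp. intros z Hz. symmetry.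
      now apply (sol_sides _ _ _ _ _ _ _ Hu).
    * apply (is_derive_const (K := R_AbsRing) (V := R_NormedModule)).
Qed.

(** * Reflection across an interface *)

Lemma interval_limit_point (a b p d : R) : a < b -> a <= p <= b -> 0 < d ->
  exists z, a < z < b /\ z <> p /\ Rabs (z - p) < d.
Proof.
intros Hab Hp Hd. destruct (Rlt_dec p b) as [Hb | Hb].
- pose proof (Rmin_l d (b - p)). pose proof (Rmin_r d (b - p)).
  assert (0 < Rmin d (b - p)) by (apply Rmin_glb_lt; lra).
  exists (p + Rmin d (b - p) / 2). repeat split; try lra. apply Rabs_def1; lra.
- pose proof (Rmin_l d (p - a)). pose proof (Rmin_r d (p - a)).
  assert (0 < Rmin d (p - a)) by (apply Rmin_glb_lt; lra).
  exists (p - Rmin d (p - a) / 2). repeat split; try lra. apply Rabs_def1; lra.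
Qed.

Lemma zero_on_closure (a b T p y t : R) (f : point -> R) :
  continuous_on (slab a b T) f -> slab a b T (p, y, t) ->
  (forall d, 0 < d -> exists z, a <= z <= b /\ Rabs (z - p) < d /\ f (z, y, t) = 0) ->
  f (p, y, t) = 0.
Proof.
intros Hf Hp Hacc. destruct (Req_dec (f (p, y, t)) 0) as [| Hne]; [assumption | exfalso].
apply Rabs_pos_lt in Hne.
destruct (proj1 (filterlim_locally _ _) (Hf _ Hp) (mkposreal _ Hne)) as [d Hd].
destruct (Hacc d (cond_pos d)) as (z & Hz & Hzp & Hfz).
assert (Hb : ball (p, y, t) d (z, y, t)).
{ repeat split; simpl; [exact Hzp | apply ball_center | apply ball_center]. }
pose proof (Hd (z, y, t) Hb) as H.
assert (Hs : slab a b T (z, y, t)) by (split; [exact Hz | apply Hp]).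
specialize (H Hs). change (Rabs (f (z, y, t) - f (p, y, t)) < Rabs (f (p, y, t))) in H.
rewrite Hfz, Rminus_0_l, Rabs_Ropp in H. lra.
Qed.

(** For [sg = -1] the reflection of the left strip, for [sg = 1] the translation of the right one:
    in both cases [s] becomes the distance to the interface at [p]. *)
Definition affine_point (p sg : R) (z : point) : point :=
  (p + sg * fst (fst z), snd (fst z), snd z).

(** Each derivative in $x$ contributes one factor [sg]; in [jxx] the two factors cancel since [sg]
    is 1 or -1. *)
Definition jet_affine (p sg : R) (j : jet) : jet :=
  let w := affine_point p sg in
  Jet (fun z => j0 j (w z)) (fun z => sg * jx j (w z)) (fun z => jy j (w z)) (fun z => jt j (w z))
    (fun z => jxx j (w z)) (fun z => jyy j (w z)) (fun z => jtt j (w z))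
    (fun z => sg * jxt j (w z)) (fun z => jyt j (w z)).

Definition jet_add (j k : jet) : jet :=
  Jet (fun z => j0 j z + j0 k z) (fun z => jx j z + jx k z) (fun z => jy j z + jy k z)
    (fun z => jt j z + jt k z) (fun z => jxx j z + jxx k z) (fun z => jyy j z + jyy k z)
    (fun z => jtt j z + jtt k z) (fun z => jxt j z + jxt k z) (fun z => jyt j z + jyt k z).

Lemma continuous_affine_point (p sg : R) (z : point) : continuous (affine_point p sg) z.
Proof.
destruct z as [[s y] t]. unfold affine_point.
apply @continuous_pair; [apply @continuous_pair |].
- apply @continuous_Rplus; [apply continuous_const |].
  apply @continuous_Rmult; [apply continuous_const |].
  apply (continuous_comp fst fst); apply continuous_fst.
- apply (continuous_comp fst snd); [apply continuous_fst | apply continuous_snd].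
- apply continuous_snd.
Qed.

Lemma is_derive_affine (f : R -> R) (p sg s l : R) :
  is_derive f (p + sg * s) l -> is_derive (fun s => f (p + sg * s)) s (sg * l).
Proof.
intros Hf. apply (is_derive_comp f (fun s => p + sg * s) s l sg Hf).
auto_derive; auto. ring.
Qed.

Lemma jet_affine_solution (c tau lam T a b a' b' p sg : R) (j : jet) :
  sg * sg = 1 ->
  (forall s, a' <= s <= b' -> a <= p + sg * s <= b) ->
  (forall s, a' < s < b' -> a < p + sg * s < b) ->
  solution_jet c tau lam T a b j -> solution_jet c tau lam T a' b' (jet_affine p sg j).
Proof.
intros Hsg Hc Ho Hj.
assert (Hslab : forall z, slab a' b' T z -> slab a b T (affine_point p sg z)).
{ intros [[s y] t] (h1 & h2 & h3). split; [now apply Hc | now split]. }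
assert (Hbox : forall z, open_box a' b' T z -> open_box a b T (affine_point p sg z)).
{ intros [[s y] t] (h1 & h2 & h3). split; [now apply Ho | now split]. }
assert (Hcc : forall f : point -> R, continuous_on (slab a b T) f ->
   continuous_on (slab a' b' T) (fun z => f (affine_point p sg z))).
{ intros f Hf. apply (continuous_on_comp _ (slab a b T)); auto using continuous_affine_point. }
assert (Hco : forall (f : point -> R) z, continuous f (affine_point p sg z) -> continuous (fun z => f (affine_point p sg z)) z).
{ intros f z Hf. apply (continuous_comp (affine_point p sg) f); [apply continuous_affine_point | exact Hf]. }
split.
- destruct (jet_cont _ _ _ _ _ _ _ Hj) as (h1 & h2 & h3 & h4). simpl.
  repeat apply conj; try (apply Hcc; assumption).
  apply (continuous_on_Rmult _ (fun _ => sg)); [| now apply Hcc].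
  apply continuous_on_continuous; intros; apply continuous_const.
- intros z Hz. destruct (jet_cont2 _ _ _ _ _ _ _ Hj _ (Hbox z Hz)) as (k1 & k2 & k3 & k4 & k5 & k6 & k7 & k8).
  simpl. repeat apply conj; try (apply Hco; assumption);
  apply (continuous_Rmult (fun _ => sg)); try apply continuous_const; apply Hco; assumption.
- intros s y t Hs Hy Ht. apply (jet_dt _ _ _ _ _ _ _ Hj); auto.
- intros s y t Hz. pose proof (Hbox _ Hz) as Hz'.
  destruct (jet_d2 _ _ _ _ _ _ _ Hj _ _ _ Hz') as (k1 & k2 & k3 & k4 & k5 & k6 & k7).
  simpl in k1, k2, k3, k4, k5, k6, k7.
  simpl. repeat match goal with |- _ /\ _ => split end; auto; unfold affine_point; simpl fst; simpl snd.
  + replace (jxx j (p + sg * s, y, t)) with (sg * (sg * jxx j (p + sg * s, y, t)))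
      by (rewrite <- Rmult_assoc, Hsg; ring).
    apply (is_derive_scal (fun s => jx j (p + sg * s, y, t))).
    now apply (is_derive_affine (fun s => jx j (s, y, t))).
  + now apply (is_derive_scal (fun t => jx j (p + sg * s, y, t))).
  + now apply (is_derive_affine (fun s => jt j (s, y, t))).
- intros s y t Hz. apply (jet_wave _ _ _ _ _ _ _ Hj _ _ _ (Hbox _ Hz)).
- intros s y t Hs Hy Ht. apply (jet_history _ _ _ _ _ _ _ Hj); auto; now apply Ho.
- intros s y Hs Hy. destruct (jet_init _ _ _ _ _ _ _ Hj (p + sg * s) y (Ho s Hs) Hy) as (h1 & h2 & h3).
  simpl. unfold affine_point; simpl. rewrite h1, h2, h3. repeat split; ring.
- intros s t Hs Ht. apply (jet_sides _ _ _ _ _ _ _ Hj); auto.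
Qed.

Lemma jet_add_solution (c tau lam T a b : R) (j k : jet) :
  solution_jet c tau lam T a b j -> solution_jet c tau lam T a b k ->
  solution_jet c tau lam T a b (jet_add j k).
Proof.
intros Hj Hk. split.
- destruct (jet_cont _ _ _ _ _ _ _ Hj) as (h1 & h2 & h3 & h4).
  destruct (jet_cont _ _ _ _ _ _ _ Hk) as (g1 & g2 & g3 & g4).
  simpl. repeat apply conj; apply @continuous_on_Rplus; assumption.
- intros z Hz. destruct (jet_cont2 _ _ _ _ _ _ _ Hj _ Hz) as (k1 & k2 & k3 & k4 & k5 & k6 & k7 & k8).
  destruct (jet_cont2 _ _ _ _ _ _ _ Hk _ Hz) as (m1 & m2 & m3 & m4 & m5 & m6 & m7 & m8).
  simpl. repeat apply conj; apply @continuous_Rplus; assumption.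
- intros s y t Hs Hy Ht. simpl.
  apply (is_derive_Rplus (fun t => j0 j (s, y, t)) (fun t => j0 k (s, y, t)));
    [apply (jet_dt _ _ _ _ _ _ _ Hj) | apply (jet_dt _ _ _ _ _ _ _ Hk)]; auto.
- intros s y t Hz.
  destruct (jet_d2 _ _ _ _ _ _ _ Hj _ _ _ Hz) as (k1 & k2 & k3 & k4 & k5 & k6 & k7).
  destruct (jet_d2 _ _ _ _ _ _ _ Hk _ _ _ Hz) as (m1 & m2 & m3 & m4 & m5 & m6 & m7).
  simpl. repeat match goal with |- _ /\ _ => split end.
  + now apply (is_derive_Rplus (fun s => jx j (s, y, t)) (fun s => jx k (s, y, t))).
  + now apply (is_derive_Rplus (fun t => jx j (s, y, t)) (fun t => jx k (s, y, t))).
  + now apply (is_derive_Rplus (fun y => jy j (s, y, t)) (fun y => jy k (s, y, t))).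
  + now apply (is_derive_Rplus (fun t => jy j (s, y, t)) (fun t => jy k (s, y, t))).
  + now apply (is_derive_Rplus (fun s => jt j (s, y, t)) (fun s => jt k (s, y, t))).
  + now apply (is_derive_Rplus (fun y => jt j (s, y, t)) (fun y => jt k (s, y, t))).
  + now apply (is_derive_Rplus (fun t => jt j (s, y, t)) (fun t => jt k (s, y, t))).
- intros s y t Hz. pose proof (jet_wave _ _ _ _ _ _ _ Hj _ _ _ Hz).
  pose proof (jet_wave _ _ _ _ _ _ _ Hk _ _ _ Hz). simpl. lra.
- intros s y t Hs Hy Ht. simpl.
  rewrite (jet_history _ _ _ _ _ _ _ Hj), (jet_history _ _ _ _ _ _ _ Hk); auto. ring.
- intros s y Hs Hy. destruct (jet_init _ _ _ _ _ _ _ Hj s y Hs Hy) as (h1 & h2 & h3).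
  destruct (jet_init _ _ _ _ _ _ _ Hk s y Hs Hy) as (g1 & g2 & g3).
  simpl. rewrite h1, h2, h3, g1, g2, g3. repeat split; ring.
- intros s t Hs Ht. destruct (jet_sides _ _ _ _ _ _ _ Hj s t Hs Ht) as (h1 & h2).
  destruct (jet_sides _ _ _ _ _ _ _ Hk s t Hs Ht) as (g1 & g2).
  simpl. rewrite h1, h2, g1, g2. split; ring.
Qed.

Lemma jet_dt_zero (c tau lam T T1 a b : R) (j : jet) :
  solution_jet c tau lam T a b j -> T1 <= T ->
  (forall s y t, open_box a b T1 (s, y, t) -> j0 j (s, y, t) = 0) ->
  forall s y t, open_box a b T1 (s, y, t) -> jt j (s, y, t) = 0.
Proof.
intros Hj HT H0 s y t (Hs & Hy & Ht).
rewrite <- (is_derive_unique (fun t => j0 j (s, y, t)) t (jt j (s, y, t)))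
  by (apply (jet_dt _ _ _ _ _ _ _ Hj); lra).
apply is_derive_unique. apply (is_derive_ext_loc (fun _ => 0)).
- generalize (open_strict_between _ _ t Ht). apply filter_imp. intros z Hz. symmetry. now apply H0.
- apply (is_derive_const (K := R_AbsRing) (V := R_NormedModule)).
Qed.

(** Adding the reflection of the left solution to the right one cancels the normal
    derivative on the interface [s = p]. *)
Lemma interface_reflection (c tau lam T T0 d p a b : R) (jl jr : jet) :
  0 < c -> 0 < tau -> 0 < d -> a < p - d -> p + d < b ->
  solution_jet c tau lam T a p jl -> solution_jet c tau lam T p b jr ->
  (forall y t, 0 < y < PI -> 0 < t < T -> jx jl (p, y, t) = jx jr (p, y, t)) ->
  (forall s y t, open_box a p (Rmin T T0) (s, y, t) -> j0 jl (s, y, t) = 0) ->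
  (forall s y t, open_box p b (Rmin T T0) (s, y, t) -> j0 jr (s, y, t) = 0) ->
  forall y t, 0 < y < PI -> 0 < t < T -> c * (t - T0) < d ->
    j0 jl (p, y, t) + j0 jr (p, y, t) = 0.
Proof.
intros Hc Htau Hd Ha Hb Hl Hr Hflux Hl0 Hr0 y t Hy Ht Hcone.
set (w := jet_add (jet_affine p (-1) jl) (jet_affine p 1 jr)).
assert (Hw : solution_jet c tau lam T 0 d w).
{ apply jet_add_solution;
  [apply (jet_affine_solution c tau lam T a p) | apply (jet_affine_solution c tau lam T p b)];
  auto; intros; lra. }
assert (Hw0 : j0 w (0, y, t) = 0).
{ destruct (jet_cont _ _ _ _ _ _ _ Hw) as (h1 & _).
  apply (zero_on_closure 0 d T); auto; [repeat split; lra |].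
  intros r Hrr.
  (* Finite speed speaks of interior points only, so the trace at 0 is reached as a limit of points
     [z] inside the strip with [z + c * (t - T0) < d]. The bound [d] is kept as well because [t] may
     precede [T0]. *)
  destruct (interval_limit_point 0 (Rmin d (d - c * (t - T0))) 0 r) as (z & Hz & _ & Hzr); auto.
  - apply Rmin_glb_lt; lra.
  - split; [lra |]. apply Rmin_glb; lra.
  - pose proof (Rmin_l d (d - c * (t - T0))). pose proof (Rmin_r d (d - c * (t - T0))).
    exists z. repeat split; try lra.
    apply (finite_speed c tau lam T 0 d T0 w Hc Htau Hw); try lra; [| | repeat split; lra].
    + intros y' t' Hy' Ht'. unfold w; simpl. unfold affine_point; simpl. rewrite !Rmult_0_r, Rplus_0_r.
      rewrite Hflux by auto. ring.
    (* The face [s = d] corresponds to [p - d] and [p + d], which are interior to the two strips;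
       both solutions are known to vanish there before [T0]. *)
    + intros y' t' Hy' Ht' Hlt. unfold w; simpl. unfold affine_point; simpl.
      assert (0 < t' < Rmin T T0) by (split; [lra | apply Rmin_glb_lt; lra]).
      rewrite (jet_dt_zero c tau lam T (Rmin T T0) a p jl Hl (Rmin_l T T0) Hl0) by (repeat split; lra).
      rewrite (jet_dt_zero c tau lam T (Rmin T T0) p b jr Hr (Rmin_l T T0) Hr0) by (repeat split; lra).
      ring. }
unfold w in Hw0; simpl in Hw0. unfold affine_point in Hw0; simpl in Hw0. rewrite !Rmult_0_r, Rplus_0_r in Hw0. exact Hw0.
Qed.

(** * Interface conditions in terms of jets *)

(** Turns a strip already shown to be zero into a zero Neumann datum for its neighbour: $u_x$
    vanishes inside and, being continuous up to the faces, on them. *)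
Lemma error_jet_flux_zero (c tau lam T T1 : R) (x : nat -> R) (i : nat) (u : point -> R) (j : jet) :
  0 < tau -> T1 <= T -> x (i - 1)%nat < x i -> error_jet c tau lam T x i u j ->
  (forall s y t, open_box (x (i - 1)%nat) (x i) T1 (s, y, t) -> u (s, y, t) = 0) ->
  forall p y t, x (i - 1)%nat <= p <= x i -> 0 < y < PI -> 0 < t < T1 -> jx j (p, y, t) = 0.
Proof.
intros Htau HT Hx Hj Hu p y t Hp Hy Ht.
destruct (jet_cont _ _ _ _ _ _ _ (error_jet_solution _ _ _ _ _ _ _ _ Hj)) as (_ & h2 & _).
apply (zero_on_closure (x (i - 1)%nat) (x i) T); [exact h2 | repeat split; lra |].
intros r Hr. destruct (interval_limit_point _ _ p r Hx Hp Hr) as (z & Hz & _ & Hzp).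
exists z. repeat split; try lra.
rewrite <- (is_derive_unique (fun s => u (s, y, t)) z (jx j (z, y, t))).
- apply is_derive_unique. apply (is_derive_ext_loc (fun _ => 0)).
  + generalize (open_strict_between _ _ z Hz). apply filter_imp. intros s Hs. symmetry. apply Hu. now repeat split.
  + apply (is_derive_const (K := R_AbsRing) (V := R_NormedModule)).
- apply (is_derive_within_interior (fun s => closed_cyl x tau T i (s, y, t))).
  + generalize (open_strict_between _ _ z Hz). apply filter_imp. intros s Hs. repeat split; lra.
  + apply (error_jet_dx _ _ _ _ _ _ _ _ Hj). repeat split; lra.
Qed.

Lemma error_jet_dirichlet_zero (c tau lam T T1 p : R) (x : nat -> R) (i : nat) (u : point -> R) (j : jet) :
  0 < tau -> T1 <= T -> error_jet c tau lam T x i u j -> x (i - 1)%nat <= p <= x i ->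
  (forall y t, 0 < y < PI -> 0 < t < T1 -> u (p, y, t) = 0) ->
  forall y t, 0 < y < PI -> 0 < t < T1 -> jt j (p, y, t) = 0.
Proof.
intros Htau HT Hj Hp Hu y t Hy Ht.
rewrite <- (is_derive_unique (fun t => u (p, y, t)) t (jt j (p, y, t))).
- apply is_derive_unique. apply (is_derive_ext_loc (fun _ => 0)).
  + generalize (open_strict_between _ _ t Ht). apply filter_imp. intros z Hz. symmetry. now apply Hu.
  + apply (is_derive_const (K := R_AbsRing) (V := R_NormedModule)).
- apply (is_derive_within_interior (fun t => closed_cyl x tau T i (p, y, t))).
  + generalize (open_strict_between _ _ t Ht). apply filter_imp. intros z Hz. repeat split; lra.
  + apply (error_jet_dt _ _ _ _ _ _ _ _ Hj). repeat split; lra.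
Qed.

Lemma dx_on_closed_cyl_unique (tau T : R) (x : nat -> R) (i : nat) (u : point -> R) (p y t q q' : R) :
  x (i - 1)%nat < x i -> closed_cyl x tau T i (p, y, t) ->
  dx_on (closed_cyl x tau T i) u p y t q -> dx_on (closed_cyl x tau T i) u p y t q' -> q = q'.
Proof.
intros Hx (Hp & Hy & Ht). apply is_derive_within_unique. intros d.
destruct (interval_limit_point _ _ p d Hx Hp (cond_pos d)) as (z & Hz & Hzp & Hd).
exists z. repeat split; auto; lra.
Qed.

Lemma neumann_sym (x : nat -> R) (tau T p : R) (i k : nat) (u v : point -> R) :
  neumann x tau T p i u k v -> neumann x tau T p k v i u.
Proof. intros H y t Hy Ht. destruct (H y t Hy Ht) as (q & h1 & h2). now exists q. Qed.

Lemma neumann_flux (c tau lam T p : R) (x : nat -> R) (i k : nat) (u v : point -> R) (j l : jet) :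
  0 < tau -> x (i - 1)%nat < x i -> x (k - 1)%nat < x k ->
  x (i - 1)%nat <= p <= x i -> x (k - 1)%nat <= p <= x k ->
  error_jet c tau lam T x i u j -> error_jet c tau lam T x k v l ->
  neumann x tau T p i u k v ->
  forall y t, 0 < y < PI -> 0 < t < T -> jx j (p, y, t) = jx l (p, y, t).
Proof.
intros Htau Hi Hk Hpi Hpk Hj Hl Hn y t Hy Ht.
destruct (Hn y t Hy Ht) as (q & h1 & h2).
assert (Hci : closed_cyl x tau T i (p, y, t)) by (repeat split; lra).
assert (Hck : closed_cyl x tau T k (p, y, t)) by (repeat split; lra).
transitivity q.
- apply (dx_on_closed_cyl_unique _ _ _ _ _ _ _ _ _ _ Hi Hci (error_jet_dx _ _ _ _ _ _ _ _ Hj _ _ _ Hci) h1).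
- apply (dx_on_closed_cyl_unique _ _ _ _ _ _ _ _ _ _ Hk Hck h2 (error_jet_dx _ _ _ _ _ _ _ _ Hl _ _ _ Hck)).
Qed.

(** * The interface iteration *)

Lemma middle_bounds (N : nat) : (2 <= N)%nat -> (1 <= middle N <= N - 1)%nat.
Proof.
intros HN. unfold middle. rewrite Nat.div2_div.
pose proof (Nat.div_mod (N + 1) 2 ltac:(lia)). pose proof (Nat.mod_upper_bound (N + 1) 2 ltac:(lia)). lia.
Qed.

Lemma dmin_le_width (x : nat -> R) (N i : nat) : (1 <= i <= N)%nat -> dmin x N <= width x i.
Proof. intros Hi. apply MinRlist_P1, in_map, in_seq. lia. Qed.

(** The relaxation mixes the trace from the strip farther from the middle with the old interface
    value. The old value is itself a trace: it is the Dirichlet datum of the strip nearer the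
    middle. With equal weights the result is symmetric in the two sides. *)
Lemma interface_update (c tau lam T : R) (x : nat -> R) (N : nat)
    (kap kap' : nat -> R -> R -> R) (e : nat -> point -> R) (i : nat) :
  (2 <= N)%nat -> dnwr_step c tau lam T (1 / 2) x N kap e kap' -> (1 <= i <= N - 1)%nat ->
  neumann x tau T (x i) i (e i) (i + 1) (e (i + 1)%nat) /\
  forall y t, 0 < y < PI -> 0 < t < T ->
    kap' i y t = (e i (x i, y, t) + e (i + 1)%nat (x i, y, t)) / 2.
Proof.
intros HN Hs Hi. pose proof (middle_bounds N HN) as Hm.
destruct (step_middle _ _ _ _ _ _ _ _ _ _ Hs) as [Hml Hmr].
destruct (Nat.lt_ge_cases i (middle N)) as [Hlt | Hge].
- destruct (step_left _ _ _ _ _ _ _ _ _ _ Hs i ltac:(lia)) as [_ Hn].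
  split; [exact Hn |]. intros y t Hy Ht.
  rewrite (step_update_left _ _ _ _ _ _ _ _ _ _ Hs i ltac:(lia) y t Hy Ht).
  assert (Hd : e (i + 1)%nat (x i, y, t) = kap i y t).
  { destruct (Nat.eq_dec (i + 1) (middle N)) as [He | He].
    - rewrite He. replace i with (middle N - 1)%nat by lia. now apply Hml.
    - destruct (step_left _ _ _ _ _ _ _ _ _ _ Hs (i + 1)%nat ltac:(lia)) as [Hd _].
      replace (i + 1 - 1)%nat with i in Hd by lia. now apply Hd. }
  rewrite Hd. lra.
- destruct (step_right _ _ _ _ _ _ _ _ _ _ Hs (i + 1)%nat ltac:(lia)) as [Hn _].
  replace (i + 1 - 1)%nat with i in Hn by lia.
  split; [now apply neumann_sym |]. intros y t Hy Ht.
  rewrite (step_update_right _ _ _ _ _ _ _ _ _ _ Hs i ltac:(lia) y t Hy Ht).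
  assert (Hd : e i (x i, y, t) = kap i y t).
  { destruct (Nat.eq_dec i (middle N)) as [-> | He].
    - now apply Hmr.
    - destruct (step_right _ _ _ _ _ _ _ _ _ _ Hs i ltac:(lia)) as [_ Hd]. now apply Hd. }
  rewrite Hd. lra.
Qed.

Lemma iterate_zero (c tau lam T T1 theta : R) (x : nat -> R) (N : nat)
    (kap kap' : nat -> R -> R -> R) (e : nat -> point -> R) (j : nat -> jet) :
  0 < c -> 0 < tau -> T1 <= T -> (2 <= N)%nat ->
  (forall i, (1 <= i <= N)%nat -> x (i - 1)%nat < x i) ->
  dnwr_step c tau lam T theta x N kap e kap' ->
  (forall i, (1 <= i <= N)%nat -> error_jet c tau lam T x i (e i) (j i)) ->
  (forall i y t, (i <= N)%nat -> 0 < y < PI -> 0 < t < T1 -> kap i y t = 0) ->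
  forall i, (1 <= i <= N)%nat ->
  forall s y t, open_box (x (i - 1)%nat) (x i) T1 (s, y, t) -> e i (s, y, t) = 0.
Proof.
intros Hc Htau HT1 HN Hx Hs Hj Hk.
pose proof (middle_bounds N HN) as Hm. set (m := middle N) in *.
destruct (step_middle _ _ _ _ _ _ _ _ _ _ Hs) as [Hml Hmr]. fold m in Hml, Hmr.
assert (Huniq : forall i, (1 <= i <= N)%nat ->
  (forall y t, 0 < y < PI -> 0 < t < T1 ->
     (jx (j i) (x (i - 1)%nat, y, t) = 0 \/ jt (j i) (x (i - 1)%nat, y, t) = 0) /\
     (jx (j i) (x i, y, t) = 0 \/ jt (j i) (x i, y, t) = 0)) ->
  forall s y t, open_box (x (i - 1)%nat) (x i) T1 (s, y, t) -> e i (s, y, t) = 0).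
{ intros i Hi Hbd s y t Hz. rewrite <- (error_jet_value _ _ _ _ _ _ _ _ (Hj i Hi)).
  apply (mixed_uniqueness c tau lam T (x (i - 1)%nat) (x i) T1); auto.
  apply (error_jet_solution _ _ _ _ _ _ _ _ (Hj i Hi)). }
assert (Hdir : forall i q p, (1 <= i <= N)%nat -> (q <= N)%nat -> x (i - 1)%nat <= p <= x i ->
  dirichlet T p (e i) (kap q) ->
  forall y t, 0 < y < PI -> 0 < t < T1 -> jt (j i) (p, y, t) = 0).
{ intros i q p Hi Hq Hp Hd.
  apply (error_jet_dirichlet_zero c tau lam T T1 p x i (e i)); auto.
  intros y t Hy Ht. rewrite Hd by lra. now apply Hk. }
assert (Hneu : forall i k p, (1 <= i <= N)%nat -> (1 <= k <= N)%nat ->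
  x (i - 1)%nat <= p <= x i -> x (k - 1)%nat <= p <= x k ->
  neumann x tau T p i (e i) k (e k) ->
  (forall s y t, open_box (x (k - 1)%nat) (x k) T1 (s, y, t) -> e k (s, y, t) = 0) ->
  forall y t, 0 < y < PI -> 0 < t < T1 -> jx (j i) (p, y, t) = 0).
{ intros i k p Hi Hk' Hpi Hpk Hn Hz y t Hy Ht.
  rewrite (neumann_flux c tau lam T p x i k (e i) (e k) (j i) (j k)); auto; try lra.
  apply (error_jet_flux_zero c tau lam T T1 x k (e k)); auto. }
(* Strips are indexed by their distance [n] to the middle: the Neumann datum of each comes from the
   strip at distance one less, and its Dirichlet datum from [kap]. *)
assert (Hright : forall n, (m + n <= N)%nat ->
  forall s y t, open_box (x (m + n - 1)%nat) (x (m + n)%nat) T1 (s, y, t) -> e (m + n)%nat (s, y, t) = 0).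
{ induction n as [| n IH]; intros Hn.
  - rewrite Nat.add_0_r. apply Huniq; [lia |]. intros y t Hy Ht. pose proof (Hx m ltac:(lia)).
    split; right; [apply (Hdir m (m - 1)%nat) | apply (Hdir m m)]; auto; try lia; lra.
  - destruct (step_right _ _ _ _ _ _ _ _ _ _ Hs (m + S n)%nat ltac:(fold m; lia)) as [Hn1 Hn2].
    replace (m + S n - 1)%nat with (m + n)%nat in * by lia.
    pose proof (Hx (m + S n)%nat ltac:(lia)) as hx1. pose proof (Hx (m + n)%nat ltac:(lia)) as hx2.
    replace (m + S n - 1)%nat with (m + n)%nat in hx1 by lia.
    pose proof (Huniq (m + S n)%nat ltac:(lia)) as Hu.
    replace (m + S n - 1)%nat with (m + n)%nat in Hu by lia.
    apply Hu. intros y t Hy Ht. split.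
    + left. apply (Hneu (m + S n)%nat (m + n)%nat); auto; try lia; try lra.
      * replace (m + S n - 1)%nat with (m + n)%nat by lia. lra.
      * apply IH. lia.
    + right. apply (Hdir (m + S n)%nat (m + S n)%nat); auto; try lia.
      replace (m + S n - 1)%nat with (m + n)%nat by lia. lra. }
assert (Hleft : forall n, (n < m)%nat ->
  forall s y t, open_box (x (m - n - 1)%nat) (x (m - n)%nat) T1 (s, y, t) -> e (m - n)%nat (s, y, t) = 0).
{ induction n as [| n IH]; intros Hn.
  - rewrite Nat.sub_0_r. pose proof (Hright 0%nat ltac:(lia)) as H0. now rewrite Nat.add_0_r in H0.
  - destruct (step_left _ _ _ _ _ _ _ _ _ _ Hs (m - S n)%nat ltac:(fold m; lia)) as [Hn1 Hn2].
    pose proof (Hx (m - S n)%nat ltac:(lia)) as hx1. pose proof (Hx (m - n)%nat ltac:(lia)) as hx2.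
    replace (m - n - 1)%nat with (m - S n)%nat in hx2 by lia.
    replace (m - S n + 1)%nat with (m - n)%nat in Hn2 by lia.
    apply Huniq; [lia |]. intros y t Hy Ht. split.
    + right. apply (Hdir (m - S n)%nat (m - S n - 1)%nat); auto; try lia; lra.
    + left. apply (Hneu (m - S n)%nat (m - n)%nat); auto; try lia; try lra.
      * replace (m - n - 1)%nat with (m - S n)%nat by lia. lra.
      * apply IH. lia. }
intros i Hi. destruct (Nat.le_gt_cases m i) as [Hle | Hgt].
- replace i with (m + (i - m))%nat by lia. apply Hright. lia.
- replace i with (m - (m - i))%nat by lia. apply Hleft. lia.
Qed.

Theorem theorem2 :
  forall (c tau lam T l L : R) (N : nat) (x : nat -> R) (k : nat)
         (kap : nat -> nat -> R -> R -> R) (e : nat -> nat -> point -> R),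
    0 < c -> 0 < tau -> 0 < T ->
    (2 <= N)%nat ->
    x 0%nat = l -> x N = L ->
    (forall i : nat, (1 <= i <= N)%nat -> x (i - 1)%nat < x i) ->
    (1 <= k)%nat ->
    T / INR k < dmin x N / c ->
    dnwr c tau lam T (1 / 2) x N kap e ->
    forall i : nat, (1 <= i <= N)%nat ->
    forall s y t : R, in_strip x i s y -> 0 < t < T ->
      e (k + 1)%nat i (s, y, t) = 0.
Proof.
intros c tau lam T l L N x k kap e Hc Htau HT HN _ _ Hx Hk HTk H.
assert (Hkpos : 0 < INR k) by (apply lt_0_INR; lia).
(* The strict hypothesis leaves a gap between [c * T / INR k] and [dmin x N]; [d] is its midpoint. A
   value strictly below every width lets the reflection fit inside both strips. *)
assert (Hd : exists d, 0 < d /\ c * T < INR k * d /\ forall i, (1 <= i <= N)%nat -> d < x i - x (i - 1)%nat).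
{ set (q := T / INR k) in *.
  assert (Hq : 0 < q) by (apply Rdiv_lt_0_compat; lra).
  assert (HqT : T = INR k * q) by (unfold q; field; lra).
  apply Rlt_div_r in HTk; [| exact Hc].
  exists ((q * c + dmin x N) / 2).
  assert (0 < q * c) by (apply Rmult_lt_0_compat; lra).
  repeat split; [lra | |].
  - rewrite HqT. replace (c * (INR k * q)) with (INR k * (q * c)) by ring.
    apply Rmult_lt_compat_l; lra.
  - intros i Hi. pose proof (dmin_le_width x N i Hi) as Hw. unfold width in Hw. lra. }
destruct Hd as (d & Hd0 & HdT & Hdw).
assert (Hj : forall n, exists j : nat -> jet, forall i, (1 <= i <= N)%nat ->
  error_jet c tau lam T x i (e (S n) i) (j i)).
{ intros n.
  apply (functional_choice (fun i j => (1 <= i <= N)%nat -> error_jet c tau lam T x i (e (S n) i) j)).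
  intros i. destruct (Compare_dec.le_dec 1 i) as [h1 | h1]; [destruct (Compare_dec.le_dec i N) as [h2 | h2] |].
  - destruct (error_solution_jet c tau lam T x i (e (S n) i)) as [j Hj]; auto.
    + apply (step_solution _ _ _ _ _ _ _ _ _ _ (dnwr_iter _ _ _ _ _ _ _ _ _ H n)). lia.
    + now exists j.
  (* Choice needs a jet at every index; outside the range [1..N] any value will do. *)
  - exists (Jet (fun _ => 0) (fun _ => 0) (fun _ => 0) (fun _ => 0) (fun _ => 0) (fun _ => 0)
      (fun _ => 0) (fun _ => 0) (fun _ => 0)). lia.
  - exists (Jet (fun _ => 0) (fun _ => 0) (fun _ => 0) (fun _ => 0) (fun _ => 0) (fun _ => 0)
      (fun _ => 0) (fun _ => 0) (fun _ => 0)). lia. }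
assert (Hit : forall n T1, T1 <= T ->
  (forall i y t, (i <= N)%nat -> 0 < y < PI -> 0 < t < T1 -> kap n i y t = 0) ->
  forall i, (1 <= i <= N)%nat ->
  forall s y t, open_box (x (i - 1)%nat) (x i) T1 (s, y, t) -> e (S n) i (s, y, t) = 0).
{ intros n T1 HT1 Hkap. destruct (Hj n) as [j Hjn].
  apply (iterate_zero c tau lam T T1 (1 / 2) x N (kap n) (kap (S n)) (e (S n)) j); auto.
  apply (dnwr_iter _ _ _ _ _ _ _ _ _ H). }
(* The initial guesses are arbitrary, and for [n = 0] the region [c * t < 0] is empty; each
   iteration then gains the travel time [d / c]. *)
assert (Hkap : forall n i y t, (i <= N)%nat -> 0 < y < PI -> 0 < t < T -> c * t < INR n * d ->
  kap n i y t = 0).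
{ induction n as [| n IH]; intros i y t Hi Hy Ht Hct.
  - simpl in Hct. pose proof (Rmult_lt_0_compat c t Hc (proj1 Ht)). lra.
  - destruct (dnwr_outer _ _ _ _ _ _ _ _ _ H (S n) y t Hy Ht) as [Ho1 Ho2].
    destruct (Nat.eq_dec i 0) as [-> | Hi0]; [exact Ho1 |].
    destruct (Nat.eq_dec i N) as [-> | HiN]; [exact Ho2 |].
    destruct (interface_update c tau lam T x N (kap n) (kap (S n)) (e (S n)) i HN
      (dnwr_iter _ _ _ _ _ _ _ _ _ H n) ltac:(lia)) as [Hn Hup].
    rewrite Hup by auto. destruct (Hj n) as [j Hjn].
    pose proof (Hjn i ltac:(lia)) as Hji. pose proof (Hjn (i + 1)%nat ltac:(lia)) as Hjk.
    pose proof (Hx i ltac:(lia)) as hx1. pose proof (Hx (i + 1)%nat ltac:(lia)) as hx2.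
    pose proof (Hdw i ltac:(lia)) as hw1. pose proof (Hdw (i + 1)%nat ltac:(lia)) as hw2.
    assert (Hi1 : (i + 1 - 1 = i)%nat) by lia.
    (* The time up to which the induction hypothesis gives zero interface values. It may lie beyond
       the window, hence [Rmin T T0] below. *)
    set (T0 := INR n * d / c).
    assert (HcT0 : c * T0 = INR n * d) by (unfold T0; field; lra).
    assert (Hz : forall q, (1 <= q <= N)%nat ->
      forall s y t, open_box (x (q - 1)%nat) (x q) (Rmin T T0) (s, y, t) -> e (S n) q (s, y, t) = 0).
    { apply Hit; [apply Rmin_l |]. intros q y' t' Hq Hy' Ht'.
      pose proof (Rmin_l T T0). pose proof (Rmin_r T T0).
      apply IH; auto; [lra |]. rewrite <- HcT0. apply Rmult_lt_compat_l; lra. }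
    pose proof (neumann_flux c tau lam T (x i) x i (i + 1) _ _ (j i) (j (i + 1)%nat) Htau hx1 hx2
      ltac:(lra) ltac:(rewrite Hi1 in *; lra) Hji Hjk Hn) as Hflux.
    pose proof (Hz i ltac:(lia)) as Hz1. pose proof (Hz (i + 1)%nat ltac:(lia)) as Hz2.
    pose proof (error_jet_solution _ _ _ _ _ _ _ _ Hji) as Hsl.
    pose proof (error_jet_solution _ _ _ _ _ _ _ _ Hjk) as Hsr.
    rewrite <- (error_jet_value _ _ _ _ _ _ _ _ Hji) in Hz1 |- *.
    rewrite <- (error_jet_value _ _ _ _ _ _ _ _ Hjk) in Hz2 |- *.
    rewrite Hi1 in *.
    rewrite (interface_reflection c tau lam T T0 d (x i) (x (i - 1)%nat) (x (i + 1)%nat)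
      (j i) (j (i + 1)%nat)); auto; try lra.
    rewrite S_INR in Hct. lra. }
intros i Hi s y t [Hs Hy] Ht.
(* After [k] updates the interface values vanish on the whole window because [c * T < INR k * d], so
   iteration [k + 1] is solved with zero data. *)
rewrite Nat.add_1_r. apply (Hit k T (Rle_refl T)); auto.
- intros q y' t' Hq Hy' Ht'. apply Hkap; auto.
  apply Rlt_trans with (2 := HdT). apply Rmult_lt_compat_l; lra.
- now repeat split.
Qed.
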